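(* A linear operator $L:\mathcal D\to\mathcal M(M(E))$ is of affine type on $M_+(E)$ and its carré-du-champ operator $\Gamma$ is an $M_+(E)$-derivation if and only if $L$ admits a representation \[Lf(\nu)=B_0(\partial f(\nu))+\langle B_1(\partial f(\nu)),\nu\rangle+\tfrac12\big(Q_0(\partial^2f(\nu))+\langle Q_1(\partial^2f(\nu)),\nu\rangle\big),\quad f\in\mathcal D,\ \nu\in M_+(E),\] for some linear operators $B_0:D\to\mathbb R$, $B_1:D\to C_\Delta(E)$, $Q_0:D\otimes D\to\mathbb R$, $Q_1:D\otimes D\to C_\Delta(E)$. The restrictions of these operators to $D_-$ and $D_-\otimes D_-$, respectively, are uniquely determined by $L$, and the functions $F,R$ in the definition of affine type satisfy $F(g)=B_0(g)+\frac12Q_0(g\otimes g)$ and $R(g)=B_1(g)+\frac12Q_1(g\otimes g)$.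
   Context: $E$ locally compact Polish, $E^\Delta$ one-point compactification; $M(E)$, $M_+(E)$ finite signed/non-negative measures; $\mathcal M(M(E))$ measurable real maps on $M(E)$. $C_\Delta(E^k)=\{f|_{E^k}:f\in C((E^\Delta)^k)\}$, $g\otimes h$ symmetrized tensor product. $D\subseteq C_\Delta(E)$ dense linear subspace containing $1$; $D\otimes D=\operatorname{span}\{g\otimes g:g\in D\}$; $D_-=\{g\in D:g\le0\}$, $D_-\otimes D_-$ the corresponding span. $\langle g,\nu^k\rangle=\int g\,d\nu^{\otimes k}$. $\mathcal D$ is the linear span of maps $\nu\mapsto\phi(\langle g_1,\nu\rangle,\dots,\langle g_m,\nu\rangle)$, $g_i\in D$, $\phi$ a polynomial or $\phi\in C_0^\infty(\mathbb R^m)$. $\partial f(\nu)=(x\mapsto\lim_{\varepsilon\to0}(f(\nu+\varepsilon\delta_x)-f(\nu))/\varepsilon)$, $\partial^2f(\nu)=((x,y)\mapsto\partial_x\partial_yf(\nu))$. $L$ is of affine type on $M_+(E)$ if there exist maps $F:D\to\mathbb R$, $R:D\to C_\Delta(E)$ with $L\exp(\langle g,\cdot\rangle)(\nu)=(F(g)+\langle R(g),\nu\rangle)\exp(\langle g,\nu\rangle)$ for all $g\in D_-$, $\nu\in M_+(E)$. The carré-du-champ operator is $\Gamma(p,q)=L(pq)-pLq-qLp$; it is an $M_+(E)$-derivation if $\Gamma(pq,r)=p\Gamma(q,r)+q\Gamma(p,r)$ on $M_+(E)$ for all $p,q,r\in\mathcal D$.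
   Formalization: The derivation property is required for p,q,r in 𝒟 with pq, pr, qr, pqr in 𝒟 (𝒟 is not closed under products); L exp(⟨g,·⟩) means Lf for every f in 𝒟 equal to exp(⟨g,·⟩) on M_+(E); C_0^∞ means smooth, vanishing at infinity; the F, R identities are for g in D_-; E is nonempty. *)

(* Defs.v *)
From HB Require Import structures.
From mathcomp Require Import all_boot all_order all_algebra.
From mathcomp Require Import all_classical all_reals all_analysis.
Set Implicit Arguments. Unset Strict Implicit. Unset Printing Implicit Defensive.
Import Order.TTheory GRing.Theory Num.Theory.
Import numFieldNormedType.Exports.
Local Open Scope classical_set_scope.
Local Open Scope ring_scope.

Section Defs.
Context (R : realType).

Definition span {X : Type} (S : set (X -> R)) (F : X -> R) : Prop :=
  exists (n : nat) (c : 'I_n -> R) (fs : 'I_n -> X -> R),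
    (forall k, S (fs k)) /\ F = (fun x => \sum_(k < n) c k * fs k x).

Definition lin_on_R {X : Type} (S : set (X -> R)) (B : (X -> R) -> R) : Prop :=
  forall (a : R) f g, S f -> S g -> B (fun x => a * f x + g x) = a * B f + B g.

Definition lin_on_fun {X Y : Type} (S : set (X -> R)) (B : (X -> R) -> (Y -> R)) :
  Prop :=
  forall (a : R) f g, S f -> S g ->
    B (fun x => a * f x + g x) = (fun y => a * B f y + B g y).

Section Space.
Context (T : ptopologicalType).

Definition completely_metrizable : Prop :=
  exists d : T -> T -> R,
    (forall x y, 0 <= d x y) /\ (forall x y, d x y = 0 <-> x = y) /\
    (forall x y, d x y = d y x) /\ (forall x y z, d x z <= d x y + d y z) /\
    (forall A : set T, open A <->
        (forall x, A x -> exists e : R, 0 < e /\ [set y | d x y < e] `<=` A)) /\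
    (forall u : nat -> T,
      (forall e : R, 0 < e -> exists N, forall m n, (N <= m)%N -> (N <= n)%N ->
          d (u m) (u n) < e) ->
      exists l, forall e : R, 0 < e -> exists N, forall n, (N <= n)%N -> d (u n) l < e).

Definition separable_space : Prop :=
  exists S : set T, countable S /\ closure S = setT.

Definition locally_compact_space : Prop :=
  forall x : T, exists K : set T, compact K /\ nbhs x K.

Definition locally_compact_polish : Prop :=
  locally_compact_space /\ separable_space /\ completely_metrizable.

(* C_Delta(E): restrictions to E of continuous functions on the one-point
   compactification E^Delta, i.e. continuous functions on E having a limit
   c (the value at the point at infinity) along the complements of compacts *)
Definition CDelta (f : T -> R) : Prop :=
  continuous f /\
  exists c : R, forall e : R, 0 < e ->
    exists K : set T, compact K /\ forall x, ~ K x -> `|f x - c| < e.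

Definition dense_subspace_with_one (D : set (T -> R)) : Prop :=
  D `<=` CDelta /\ D (fun _ => 1) /\
  (forall (a : R) f g, D f -> D g -> D (fun x => a * f x + g x)) /\
  (forall f, CDelta f -> forall e : R, 0 < e ->
     exists g, D g /\ forall x, `|f x - g x| < e).

Definition Dminus (D : set (T -> R)) : set (T -> R) :=
  [set g | D g /\ forall x, g x <= 0].

Definition tsq (g : T -> R) : T * T -> R := fun p => g p.1 * g p.2.

Definition DD (D : set (T -> R)) : set (T * T -> R) := span (tsq @` D).

Definition DDminus (D : set (T -> R)) : set (T * T -> R) := span (tsq @` Dminus D).

Definition borelT := g_sigma_algebraType (@open T).

Definition MM := {charge set borelT -> \bar R}.

Definition Mplus (nu : MM) : Prop := forall A : set borelT, measurable A -> (0 <= nu A)%E.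

(* <g, nu> = int g d nu, computed through any decomposition nu = m1 - m2
   of nu into finite (non-negative) measures *)
Definition mint (g : T -> R) (nu : MM) : R :=
  xget 0 [set c | exists m1 m2 : {finite_measure set borelT -> \bar R},
     (forall A, measurable A -> nu A = (m1 A - m2 A)%E) /\
     c = fine (\int[m1]_x (g x)%:E) - fine (\int[m2]_x (g x)%:E)].

Definition shift (nu : MM) (x : T) (e : R) : MM :=
  cadd nu (cscale e (charge_of_finite_measure (@dirac _ borelT x R))).

Definition pd (f : MM -> R) (nu : MM) : T -> R :=
  fun x => 'D_1 (fun e : R => f (shift nu x e)) 0.

Definition pd2 (f : MM -> R) (nu : MM) : T * T -> R :=
  fun p => pd (fun nu' => pd f nu' p.2) nu p.1.

Definition Mgen : set (set MM) :=
  [set S | exists (A : set borelT) (c : R), measurable A /\ S = [set nu : MM | (nu A < c%:E)%E]].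

Definition Mmeasurable (F : MM -> R) : Prop :=
  forall B : set R, measurable B -> <<s Mgen >> (F @^-1` B).

Inductive polyfun (m : nat) : ('rV[R]_m -> R) -> Prop :=
  | pf_const (c : R) : polyfun (fun _ => c)
  | pf_coord (i : 'I_m) : polyfun (fun v => v ord0 i)
  | pf_add f g : polyfun f -> polyfun g -> polyfun (fun v => f v + g v)
  | pf_mul f g : polyfun f -> polyfun g -> polyfun (fun v => f v * g v).

Fixpoint iter_pd (m : nat) (s : seq 'I_m) (f : 'rV[R]_m -> R) : 'rV[R]_m -> R :=
  if s is i :: s' then (fun v => 'D_(delta_mx ord0 i) (iter_pd s' f) v) else f.

Definition smooth (m : nat) (f : 'rV[R]_m -> R) : Prop :=
  forall s : seq 'I_m, continuous (iter_pd s f) /\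
    forall (i : 'I_m) (v : 'rV[R]_m), derivable (iter_pd s f) v (delta_mx ord0 i).

Definition C0inf (m : nat) (f : 'rV[R]_m -> R) : Prop :=
  smooth f /\
  forall e : R, 0 < e -> exists r : R, forall v : 'rV[R]_m, r < `|v| -> `|f v| < e.

Definition Dbasic (D : set (T -> R)) (F : MM -> R) : Prop :=
  exists (m : nat) (gs : 'I_m -> T -> R) (phi : 'rV[R]_m -> R),
    (forall i, D (gs i)) /\ (polyfun phi \/ C0inf phi) /\
    F = (fun nu => phi (\row_(i < m) mint (gs i) nu)).

Definition Dcal (D : set (T -> R)) : set (MM -> R) := span (Dbasic D).

Definition linear_L (D : set (T -> R)) (L : (MM -> R) -> (MM -> R)) : Prop :=
  lin_on_fun (Dcal D) L.

(* F, Rf witness that L is of affine type on M_+(E).  Since exp(<g,.>) is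
   not itself an element of cal D, "L exp(<g,.>)" is read as L f for any
   f in cal D coinciding with exp(<g,.>) on M_+(E). *)
Definition affine_wit (D : set (T -> R)) (L : (MM -> R) -> (MM -> R))
    (F : (T -> R) -> R) (Rf : (T -> R) -> (T -> R)) : Prop :=
  (forall g, D g -> CDelta (Rf g)) /\
  forall g, Dminus D g -> forall f, Dcal D f ->
    (forall nu, Mplus nu -> f nu = expR (mint g nu)) ->
    forall nu, Mplus nu -> L f nu = (F g + mint (Rf g) nu) * expR (mint g nu).

Definition affine_type (D : set (T -> R)) (L : (MM -> R) -> (MM -> R)) : Prop :=
  exists F Rf, affine_wit D L F Rf.

Definition Gamma (L : (MM -> R) -> (MM -> R)) (p q : MM -> R) : MM -> R :=
  fun nu => L (fun mu => p mu * q mu) nu - p nu * L q nu - q nu * L p nu.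

(* Gamma is an M_+(E)-derivation (on all p, q, r in cal D for which the
   products entering the identity are again in cal D) *)
Definition derivation (D : set (T -> R)) (L : (MM -> R) -> (MM -> R)) : Prop :=
  forall p q r, Dcal D p -> Dcal D q -> Dcal D r ->
    Dcal D (fun mu => p mu * q mu) -> Dcal D (fun mu => q mu * r mu) ->
    Dcal D (fun mu => p mu * r mu) -> Dcal D (fun mu => p mu * q mu * r mu) ->
    forall nu, Mplus nu ->
      Gamma L (fun mu => p mu * q mu) r nu = p nu * Gamma L q r nu + q nu * Gamma L p r nu.

Definition is_rep (D : set (T -> R)) (L : (MM -> R) -> (MM -> R))
    (B0 : (T -> R) -> R) (B1 : (T -> R) -> (T -> R))
    (Q0 : (T * T -> R) -> R) (Q1 : (T * T -> R) -> (T -> R)) : Prop :=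
  lin_on_R D B0 /\ lin_on_fun D B1 /\ (forall g, D g -> CDelta (B1 g)) /\
  lin_on_R (DD D) Q0 /\ lin_on_fun (DD D) Q1 /\ (forall h, DD D h -> CDelta (Q1 h)) /\
  forall f, Dcal D f -> forall nu, Mplus nu ->
    L f nu = B0 (pd f nu) + mint (B1 (pd f nu)) nu
             + 2^-1 * (Q0 (pd2 f nu) + mint (Q1 (pd2 f nu)) nu).

End Space.
End Defs.

(* Main.v *)
(* Fix nu in M_+(E).  If p, q, r vanish at nu, the derivation property gives
   L(pqr)(nu) = 0.  For f = phi(<g_1,.>, ..., <g_m,.>), Hadamard's lemma writes
   phi minus its second order Taylor polynomial at a = (<g_i,nu>)_i as a sum of
   terms (y_i - a_i)(y_j - a_j)(y_k - a_k) psi_ijk(y); after a cut-off these are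
   triple products of elements of the domain, so Lf(nu) only depends on the
   2-jet of phi at a:
     Lf(nu) = B(df(nu))(nu) + 1/2 Q(d^2f(nu))(nu),
   where B(g) = L<g,.> and Q(h)(nu) = L(mu |-> <h,(mu - nu)^2>)(nu).
   Applied to exp(<g,.>), made an element of the domain by a smooth cut-off of
   exp on (0,oo), this yields B(g) + 1/2 Q(g (x) g) = F(g) + <R(g),.> for g <= 0.
   Replacing g by 2g separates B and Q, both of which are thus affine in nu
   on M_+(E); this extends to D because D = D_- - D_-.
   Conversely, a representation makes Gamma(p,q) a linear functional of the
   symmetrized product dp (x) dq, hence a derivation. *)

Require Import Defs.
From HB Require Import structures.
From mathcomp Require Import all_boot all_order all_algebra.
From mathcomp Require Import all_classical all_reals all_analysis.
From mathcomp Require Import measurable_realfun.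
From mathcomp Require Import ring lra.
Import Order.TTheory GRing.Theory Num.Theory.
Import numFieldNormedType.Exports.
Local Open Scope classical_set_scope.
Local Open Scope ring_scope.

(** * Integration against signed measures *)

Section Integration.
Context {R : realType} {T : ptopologicalType}.
Implicit Types (f g : T -> R) (nu : MM R T).

(** The obstacle is that [Dcal D] is not an algebra: a polynomial times a function in [C0inf] need
    not lead back into the domain, so each use of the derivation property must come with all the
    products it involves. Two kinds of factors allow this: polynomials, and smooth compactly
    supported functions, which absorb any smooth factor. The Taylor remainder is in general of
    neither kind. It is therefore cut into a compactly supported part and a part away from the base
    point, whose factors [1 - chi] differ from 1 by compactly supported functions and so never lead
    out of the domain. Smoothness is given by partial derivatives along the axes; Hadamard's lemma,
    proved one coordinate at a time, also supplies the derivative in an arbitrary direction, which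
    perturbing [nu] by a Dirac mass calls for. The exponential identity holds on M_+(E) only, and
    subtracting a Dirac mass may leave this cone; since elements of the domain have two-sided
    derivatives, right derivatives suffice. Pairing h with (mu - nu)^2 by iterated integrals makes
    Q(h) independent of the way h is written as a span. *)

Lemma CDelta_bounded f : CDelta f -> exists M, 0 <= M /\ forall x, `|f x| <= M.
Proof.
move=> [cf [c /(_ 1 ltr01) [K [cK Kc]]]].
have [N [_ KN]] := compact_bounded (continuous_compact (@continuous_subspaceT _ _ K f cf) cK).
have c0 := normr_ge0 c; have N0 := normr_ge0 N.
exists (`|c| + 1 + (`|N| + 1)); split; first by lra.
move=> x; have [Kx|/Kc fxc] := pselect (K x).
  have N1 : N < `|N| + 1 by rewrite (le_lt_trans (ler_norm _))// ltrDl.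
  by have /= := KN _ N1 (f x) (ex_intro2 _ _ x Kx erefl); lra.
have : `|f x| <= `|c| + `|f x - c| by rewrite -{1}(subrK c (f x)) addrC ler_normD.
by move=> /le_trans; apply; have := normr_ge0 N; lra.
Qed.

Lemma continuous_borel_measurable f : continuous f ->
  measurable_fun setT (f : borelT T -> R).
Proof.
move=> /continuousP cf; apply: (measurability _ (measurable_realfun.RGenOpens.measurableE R)).
move=> _ [_ [a [b ->] <-]]; rewrite setTI; apply: sub_sigma_algebra.
exact/cf/interval_open.
Qed.

Lemma CDelta_measurable f : CDelta f ->
  measurable_fun setT (EFin \o f : borelT T -> \bar R).
Proof.
by move=> [cf _]; apply/measurable_EFinP; exact: continuous_borel_measurable.
Qed.

Lemma CDelta_integrable f (m : {finite_measure set (borelT T) -> \bar R}) :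
  CDelta f -> m.-integrable setT (fun x => (f x)%:E).
Proof.
move=> Cf; apply: measurable_bounded_integrable => //.
- by rewrite ltey_eq fin_num_measure.
- by apply: continuous_borel_measurable; case: Cf.
- have [M [_ fM]] := CDelta_bounded f Cf.
  exists M; split; first exact: num_real.
  by move=> x Mx y _ /=; rewrite (le_trans (fM y))// ltW.
Qed.

Lemma CDelta_int_fin f (m : {finite_measure set (borelT T) -> \bar R}) :
  CDelta f -> (\int[m]_x (f x)%:E)%E \is a fin_num.
Proof. by move=> Cf; apply: integrable_fin_num => //; exact: CDelta_integrable. Qed.

Lemma MM_decomp nu : exists m1 m2 : {finite_measure set (borelT T) -> \bar R},
  forall A, measurable A -> nu A = (m1 A - m2 A)%E.
Proof.
have [P [N nuPN]] := Hahn_decomposition nu.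
exists (jordan_pos nuPN), (jordan_neg nuPN) => A mA.
by rewrite (jordan_decomp nuPN mA) /cadd /= cscaleN1.
Qed.

Lemma CDelta_int_eq f (m1 m2 m3 m4 : {finite_measure set (borelT T) -> \bar R}) :
  CDelta f -> (forall A, measurable A -> m1 A + m2 A = m3 A + m4 A)%E ->
  fine (\int[m1]_x (f x)%:E) + fine (\int[m2]_x (f x)%:E) =
  fine (\int[m3]_x (f x)%:E) + fine (\int[m4]_x (f x)%:E).
Proof.
move=> Cf mE; rewrite -!fineD ?CDelta_int_fin//.
rewrite -(@integral_measure_add _ _ _ m1 m2) ?CDelta_integrable//.
rewrite -(@integral_measure_add _ _ _ m3 m4) ?CDelta_integrable//.
congr fine; apply: eq_measure_integral => A mA _.
by have := mE _ mA; rewrite -!measure_addE.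
Qed.

(** [xget] picks some decomposition. Adding two decompositions crosswise turns equality of
    differences into equality of sums of non-negative measures, where additivity of the integral
    applies. *)
Lemma mintE f nu (m1 m2 : {finite_measure set (borelT T) -> \bar R}) :
  CDelta f -> (forall A, measurable A -> nu A = (m1 A - m2 A)%E) ->
  mint f nu = fine (\int[m1]_x (f x)%:E) - fine (\int[m2]_x (f x)%:E).
Proof.
move=> Cf nuE; rewrite /mint; case: xgetP => [_ _ [n1 [n2 [nuE' ->]]]|]; last first.
  by move=> /(_ (fine (\int[m1]_x (f x)%:E) - fine (\int[m2]_x (f x)%:E))) /= []; exists m1, m2.
apply/eqP; rewrite subr_eq addrAC eq_sym subr_eq eq_sym; apply/eqP.
apply: CDelta_int_eq => // A mA.
have := nuE' _ mA; rewrite (nuE _ mA).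
have : m1 A \is a fin_num by rewrite fin_num_measure.
have : m2 A \is a fin_num by rewrite fin_num_measure.
have : n1 A \is a fin_num by rewrite fin_num_measure.
have : n2 A \is a fin_num by rewrite fin_num_measure.
case: (m1 A) => // a; case: (m2 A) => // b; case: (n1 A) => // c; case: (n2 A) => // d _ _ _ _.
rewrite -!EFinD => -[E]; congr EFin.
by lra.
Qed.

Lemma CDelta_lin a f g : CDelta f -> CDelta g -> CDelta (fun x => a * f x + g x).
Proof.
move=> [cf [c fc]] [cg [d gd]]; split.
  move=> x; apply: cvgD; last exact: cg.
  by apply: cvgM; [exact: cvg_cst|exact: cf].
exists (a * c + d) => e e0.
have a0 : 0 < `|a| + 1 by rewrite ltr_wpDl.
have [K [cK fK]] := fc (e / 2 / (`|a| + 1)) (divr_gt0 (divr_gt0 e0 (ltr0Sn _ 1)) a0).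
have [K' [cK' gK]] := gd (e / 2) (divr_gt0 e0 (ltr0Sn _ 1)).
exists (K `|` K'); split; first exact: compactU.
move=> x /not_orP[/fK Hf /gK Hg].
have -> : a * f x + g x - (a * c + d) = a * (f x - c) + (g x - d) by ring.
rewrite (le_lt_trans (ler_normD _ _))// [ltRHS](splitr e) ler_ltD//.
rewrite normrM ltW//; apply: (@le_lt_trans _ _ ((`|a| + 1) * `|f x - c|)).
  by rewrite ler_wpM2r// lerDl.
by rewrite mulrC -ltr_pdivlMr.
Qed.

Lemma CDelta_cst c : CDelta (fun _ : T => c : R).
Proof.
split; first by move=> x; exact: cvg_cst.
by exists c => e e0; exists set0; split; [exact: compact0|move=> x _; rewrite subrr normr0].
Qed.

Lemma CDelta_int_lin a f g (m : {finite_measure set (borelT T) -> \bar R}) :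
  CDelta f -> CDelta g ->
  fine (\int[m]_x (a * f x + g x)%:E) =
  a * fine (\int[m]_x (f x)%:E) + fine (\int[m]_x (g x)%:E).
Proof.
move=> Cf Cg; under eq_integral do rewrite EFinD EFinM.
have If := CDelta_integrable f m Cf; have Ig := CDelta_integrable g m Cg.
rewrite integralD//; last exact: integrableZl.
by rewrite integralZl// fineD ?fineM ?fin_numM ?CDelta_int_fin.
Qed.

Lemma mint_lin a f g nu : CDelta f -> CDelta g ->
  mint (fun x => a * f x + g x) nu = a * mint f nu + mint g nu.
Proof.
move=> Cf Cg; have [m1 [m2 nuE]] := MM_decomp nu.
rewrite !(mintE _ nu m1 m2)//; last exact: CDelta_lin.
by rewrite !CDelta_int_lin//; ring.
Qed.

Lemma mint_cst0 nu : mint (fun _ => 0) nu = 0.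
Proof.
have C0 := CDelta_cst 0.
have := mint_lin (-1) _ _ nu C0 C0.
under [X in mint X]eq_fun do rewrite mulr0 addr0.
by move=> ->; rewrite mulN1r addNr.
Qed.

Lemma mint_dirac f x : CDelta f ->
  mint f (charge_of_finite_measure (@dirac _ (borelT T) x R)) = f x.
Proof.
move=> Cf; rewrite (mintE f _ (@dirac _ (borelT T) x R) mzero)//; last first.
  by move=> A mA /=; rewrite /mzero /= sube0.
rewrite integral_measure_zero subr0 integral_dirac//; last exact: (CDelta_measurable _ Cf).
by rewrite diracT mul1e.
Qed.

Lemma mint_czero f : CDelta f -> mint f (czero : MM R T) = 0.
Proof.
move=> Cf; rewrite (mintE f _ mzero mzero)//; last by move=> A mA /=; rewrite /mzero /= sube0.
by rewrite subrr.
Qed.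

(** With the two instances below, sums of finite measures can serve as decompositions in
    [mint_cadd]. *)
Lemma finite_measure_add (m1 m2 : {finite_measure set (borelT T) -> \bar R}) :
  fin_num_fun (measure_add m1 m2).
Proof. by move=> A mA; rewrite measure_addE fin_numD !fin_num_measure. Qed.

HB.instance Definition _ (m1 m2 : {finite_measure set (borelT T) -> \bar R}) :=
  Measure.copy (measure_add m1 m2) (msum (fun n => if n is 0%N then (m1 : {measure set (borelT T) -> \bar R}) else m2) 2).

HB.instance Definition _ (m1 m2 : {finite_measure set (borelT T) -> \bar R}) :=
  @Measure_isFinite.Build _ _ _ (measure_add m1 m2) (finite_measure_add m1 m2).

Lemma mint_cadd f nu nu' : CDelta f ->
  mint f (cadd nu nu' : MM R T) = mint f nu + mint f nu'.
Proof.
move=> Cf; have [m1 [m2 nuE]] := MM_decomp nu.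
have [n1 [n2 nuE']] := MM_decomp nu'.
rewrite (mintE f nu m1 m2)// (mintE f nu' n1 n2)//.
rewrite (mintE f _ (measure_add m1 n1) (measure_add m2 n2))//; last first.
  move=> A mA; rewrite [RHS](_ : _ = (m1 A + n1 A - (m2 A + n2 A))%E); last by congr (_ - _)%E; exact: measure_addE.
  rewrite [LHS](_ : _ = (nu A + nu' A)%E)// nuE// nuE'//.
  by rewrite fin_num_oppeD ?fin_num_measure// addeACA.
rewrite !integral_measure_add ?CDelta_integrable//; [|exact: (CDelta_measurable _ Cf)..].
rewrite [X in X - _ = _]fineD ?CDelta_int_fin// [X in _ - X = _]fineD ?CDelta_int_fin//.
by ring.
Qed.

(** The scaling rule for integrals wants a non-negative scalar and a non-negative integrand. For
    negative [e] the mass goes into the subtracted measure; a general [f] is first raised by a bound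
    [M]. *)
Lemma mint_cscale_dirac f x e : CDelta f ->
  mint f (cscale e (charge_of_finite_measure (@dirac _ (borelT T) x R)) : MM R T) = e * f x.
Proof.
have ge0_case g : CDelta g -> (forall y, 0 <= g y) ->
    mint g (cscale e (charge_of_finite_measure (@dirac _ (borelT T) x R)) : MM R T) = e * g x.
  move=> Cg g0.
  have kg (r : {nonneg R}) :
      fine (\int[mscale r (@dirac _ (borelT T) x R)]_y (g y)%:E) = r%:num * g x.
    rewrite ge0_integral_mscale//; [|exact: (CDelta_measurable _ Cg)|by move=> y _; rewrite lee_fin].
    by rewrite integral_dirac//; [rewrite diracT mul1e|exact: (CDelta_measurable _ Cg)].
  have [e0|e0] := leP 0 e.
    rewrite (mintE g _ (mscale (NngNum e0) (@dirac _ (borelT T) x R)) mzero)//.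
      by rewrite integral_measure_zero (kg (NngNum e0)) subr0.
    by move=> A mA; rewrite /= /mzero sube0.
  have Ne0 : 0 <= - e by rewrite oppr_ge0 ltW.
  rewrite (mintE g _ mzero (mscale (NngNum Ne0) (@dirac _ (borelT T) x R)))//.
    by rewrite integral_measure_zero (kg (NngNum Ne0)) sub0r mulNr opprK.
  by move=> A mA; rewrite /= add0e /cscale /= mulNr opprK EFinM.
move=> Cf; have [M [M0 fM]] := CDelta_bounded f Cf.
have CM := CDelta_cst M.
have CfM : CDelta (fun y => 1 * f y + M) by exact: CDelta_lin.
have -> : f = (fun y => (-1) * M + (1 * f y + M)) by apply/funext => y; ring.
rewrite (mint_lin _ (fun=> M))// ge0_case// ge0_case//; first by ring.
by move=> y; rewrite mul1r -lerBlDr sub0r lerNl; have := fM y; rewrite ler_norml => /andP[]; lra.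
Qed.

Lemma mint_shift f nu x e : CDelta f -> mint f (Defs.shift nu x e) = mint f nu + e * f x.
Proof. by move=> Cf; rewrite /Defs.shift mint_cadd// mint_cscale_dirac. Qed.

Lemma mint_le0 g nu : CDelta g -> (forall x, g x <= 0) -> Mplus nu -> mint g nu <= 0.
Proof.
move=> Cg g0 nu0; have [m1 [m2 nuE]] := MM_decomp nu.
have C0 := CDelta_cst 0.
have CNg : CDelta (fun x => -1 * g x + 0) by exact: CDelta_lin.
rewrite (mintE g nu m1 m2)// subr_le0 -lerN2.
have NgE (m : {finite_measure set (borelT T) -> \bar R}) :
    - fine (\int[m]_x (g x)%:E) = fine (\int[m]_x (-1 * g x + 0)%:E).
  by rewrite CDelta_int_lin// integral0 /= addr0 mulN1r.
rewrite !NgE fine_le ?CDelta_int_fin//.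
apply: ge0_le_measure_integral => //.
- by move=> A mA; rewrite -sube_ge0 ?fin_num_measure// -nuE//; exact: nu0.
- by move=> x; rewrite lee_fin; have := g0 x; lra.
- exact: (CDelta_measurable _ CNg).
Qed.

Lemma Mplus_czero : Mplus (czero : MM R T).
Proof. by move=> A mA; rewrite /czero. Qed.

Lemma Mplus_dirac x : Mplus (charge_of_finite_measure (@dirac _ (borelT T) x R)).
Proof. by move=> A mA; exact: measure_ge0. Qed.

Lemma Mplus_shift nu x e : 0 <= e -> Mplus nu -> Mplus (Defs.shift nu x e).
Proof.
move=> e0 nu0 A mA; apply: adde_ge0; first exact: nu0.
by apply: mule_ge0; [rewrite lee_fin|exact: measure_ge0].
Qed.

End Integration.

(** * Smooth functions of several variables *)

Section PartialDerivatives.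
Context {R : realType}.

Section Smooth.
Context {m : nat}.
Notation V := 'rV[R]_m.
Implicit Types (f g : V -> R) (v w : V) (i j : 'I_m).

Definition pderiv i f : V -> R := fun v => 'D_(delta_mx ord0 i) f v.

(** A coinduction principle: [smooth] is the largest good class, so smoothness of a function is
    shown by exhibiting a good class that contains it. *)
Definition good_class (C : set (V -> R)) := forall f, C f ->
  continuous f /\ forall i, (forall v, derivable f v (delta_mx ord0 i)) /\ C (pderiv i f).

Lemma good_class_smooth C f : good_class C -> C f -> smooth f.
Proof.
move=> HC Cf s.
have Cs : C (iter_pd s f) by elim: s => //= i s IH; have [_ /(_ i) []] := HC _ IH.
by have [cs ds] := HC _ Cs; split => // i v; have [] := ds i.
Qed.

Lemma iter_pd_cat s t f : iter_pd (s ++ t) f = iter_pd s (iter_pd t f).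
Proof. by elim: s => //= i s ->. Qed.

Lemma smooth_good : good_class (@smooth R m).
Proof.
move=> f sf; have [cf df] := sf [::]; split; first exact: cf.
move=> i; split; first exact: (df i).
move=> s.
(* [iter_pd] applies the head of the list last, so the innermost derivative is the last entry. *)
by have := sf (rcons s i); rewrite -cats1 iter_pd_cat.
Qed.

Lemma smooth_continuous f : smooth f -> continuous f.
Proof. by move=> /smooth_good []. Qed.

Lemma smooth_derivable f v i : smooth f -> derivable f v (delta_mx ord0 i).
Proof. by move=> /smooth_good [_ /(_ i) []]. Qed.

Lemma smooth_pderiv f i : smooth f -> smooth (pderiv i f).
Proof. by move=> /smooth_good [_ /(_ i) []]. Qed.

Lemma pderivD f g i : (forall v, derivable f v (delta_mx ord0 i)) ->
  (forall v, derivable g v (delta_mx ord0 i)) ->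
  pderiv i (fun v => f v + g v) = (fun v => pderiv i f v + pderiv i g v).
Proof. by move=> df dg; apply/funext => v; rewrite /pderiv (deriveD (df v) (dg v)). Qed.

Lemma pderivM f g i : (forall v, derivable f v (delta_mx ord0 i)) ->
  (forall v, derivable g v (delta_mx ord0 i)) ->
  pderiv i (fun v => f v * g v) = (fun v => pderiv i f v * g v + f v * pderiv i g v).
Proof.
move=> df dg; apply/funext => v.
by rewrite /pderiv (deriveM (df v) (dg v)) addrC [_ *: _]mulrC.
Qed.

Inductive alg (C : set (V -> R)) : (V -> R) -> Prop :=
  | alg_base f : C f -> alg C f
  | alg_cst c : alg C (fun _ => c)
  | alg_add f g : alg C f -> alg C g -> alg C (fun v => f v + g v)
  | alg_mul f g : alg C f -> alg C g -> alg C (fun v => f v * g v).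

(* Enough to check that the partial derivatives of the generators are again
   polynomials in the generators. *)
Lemma alg_smooth C : (forall f, C f ->
    continuous f /\ forall i, (forall v, derivable f v (delta_mx ord0 i)) /\ alg C (pderiv i f)) ->
  alg C `<=` @smooth R m.
Proof.
move=> HC f; apply: good_class_smooth => {}f.
elim=> {f} [f /HC//|c|f g _ [cf df] _ [cg dg]|f g Cf [cf df] Cg [cg dg]].
- split; first by move=> v; exact: (@cst_continuous V R c).
  move=> i; split; first by move=> v; exact: derivable_cst.
  rewrite (_ : pderiv i _ = fun=> 0); first exact: alg_cst.
  by apply/funext => v; exact: derive_cst.
- split; first by move=> v; exact: (cvgD (cf v) (cg v)).
  move=> i; have [dfi Cfi] := df i; have [dgi Cgi] := dg i; split.
    by move=> v; exact: derivableD.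
  by rewrite pderivD//; exact: alg_add.
- split; first by move=> v; exact: (cvgM (cf v) (cg v)).
  move=> i; have [dfi Cfi] := df i; have [dgi Cgi] := dg i; split.
    by move=> v; exact: derivableM.
  by rewrite pderivM//; apply: alg_add; exact: alg_mul.
Qed.

(** Taking all smooth functions as generators gives stability under constants, sums and products in
    one stroke. *)
Lemma alg_smooth_smooth : alg (@smooth R m) `<=` @smooth R m.
Proof.
apply: alg_smooth => f sf; have [cf df] := smooth_good f sf; split => // i.
by have [? ?] := df i; split => //; exact: alg_base.
Qed.

Lemma smooth_cst c : smooth (fun _ : V => c : R).
Proof. by apply: alg_smooth_smooth; exact: alg_cst. Qed.

Lemma smoothD f g : smooth f -> smooth g -> smooth (fun v => f v + g v).
Proof. by move=> sf sg; apply: alg_smooth_smooth; apply: alg_add; exact: alg_base. Qed.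

Lemma smoothM f g : smooth f -> smooth g -> smooth (fun v => f v * g v).
Proof. by move=> sf sg; apply: alg_smooth_smooth; apply: alg_mul; exact: alg_base. Qed.

Lemma smoothZ c f : smooth f -> smooth (fun v => c * f v).
Proof. by apply: smoothM; exact: smooth_cst. Qed.

Lemma smoothB f g : smooth f -> smooth g -> smooth (fun v => f v - g v).
Proof.
move=> sf sg; under eq_fun do rewrite -mulN1r.
exact: (smoothD _ _ sf (smoothZ (-1) _ sg)).
Qed.

Lemma smooth_sum (I : Type) (r : seq I) (F : I -> V -> R) :
  (forall k, smooth (F k)) -> smooth (fun v => \sum_(k <- r) F k v).
Proof.
move=> sF; elim: r => [|k r IH].
  by under eq_fun do rewrite big_nil; exact: smooth_cst.
by under eq_fun do rewrite big_cons; exact: (smoothD _ _ (sF k) IH).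
Qed.

Lemma smooth_prod (I : Type) (r : seq I) (F : I -> V -> R) :
  (forall k, smooth (F k)) -> smooth (fun v => \prod_(k <- r) F k v).
Proof.
move=> sF; elim: r => [|k r IH].
  by under eq_fun do rewrite big_nil; exact: smooth_cst.
by under eq_fun do rewrite big_cons; exact: (smoothM _ _ (sF k) IH).
Qed.

(** The witness is the whole sequence of derivatives, so that no iterated derivative has to be
    computed. *)
Definition smooth1 (h : R -> R) := exists H : nat -> R -> R,
  H 0%N = h /\ forall (n : nat) (x : R), is_derive x 1 (H n) (H n.+1 x).

Lemma coord_along v i j (h : R) : (h *: (delta_mx ord0 j : V) + v) ord0 i =
  v ord0 i + h * (i == j)%:R.
Proof. by rewrite !mxE /= addrC. Qed.

(** Brings directional derivatives down to one variable, where the ordinary chain rule applies. *)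
Lemma is_derive_lineP f v w df :
  is_derive v w f df <-> is_derive (0 : R) 1 (fun h => f (h *: w + v)) df.
Proof.
have E : derive f v w = derive (fun h : R => f (h *: w + v)) 0 1.
  rewrite /derive; set g1 := fun h => h^-1 *: _; set g2 := fun h => h^-1 *: _.
  suff -> : g1 = g2 by []; apply/funext => h; rewrite /g1 /g2 /=.
  by rewrite addr0 scale0r add0r [_%:A]mulr1.
split=> -[Df <-]; apply: DeriveDef.
- exact: (proj1 (derivable1P f v w) Df).
- by rewrite E.
- exact: (proj2 (derivable1P f v w) Df).
- by rewrite E.
Qed.

Lemma is_derive_affine (a c t : R) : is_derive t (1 : R) (fun t => a + t * c) c.
Proof.
have D := @is_deriveD R R R (cst a) (id * cst c) t 1 0 (t *: 0 + c *: 1)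
  (is_derive_cst _ _ _) (is_deriveM (is_derive_id _ _) (is_derive_cst _ _ _)).
by apply: (is_derive_eq D); rewrite scaler0 !add0r; exact: mulr1.
Qed.

Lemma is_derive_coord (h : R -> R) dh v i j :
  is_derive (v ord0 i) 1 h dh ->
  is_derive v (delta_mx ord0 j) (fun w : V => h (w ord0 i)) ((i == j)%:R * dh).
Proof.
move=> Dh; apply/is_derive_lineP; rewrite mulrC.
under eq_fun do rewrite coord_along.
apply: (@is_derive1_comp _ h _ _ _ _ _ (is_derive_affine _ _ _)).
by rewrite mul0r addr0.
Qed.

Lemma smooth1_coord (h : R -> R) i : smooth1 h -> smooth (fun v : V => h (v ord0 i)).
Proof.
move=> [H [<- dH]].
pose C : set (V -> R) := [set f | exists n, f = fun v => H n (v ord0 i)].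
apply: (alg_smooth C); last by apply: alg_base; exists 0%N.
move=> _ [n ->]; split.
  move=> v; apply: continuous_comp; first exact: coord_continuous.
  by apply: differentiable_continuous; apply/derivable1_diffP; have [] := dH n (v ord0 i).
move=> j; split.
  by move=> v; have [] := is_derive_coord (H n) _ v i j (dH n _).
rewrite (_ : pderiv j _ = fun v => (i == j)%:R * H n.+1 (v ord0 i)).
  by apply: alg_mul; [exact: alg_cst|apply: alg_base; exists n.+1].
by apply/funext => v; have [_] := is_derive_coord (H n) _ v i j (dH n _).
Qed.

Lemma smooth_coord i : smooth (fun v : V => v ord0 i).
Proof.
apply: (smooth1_coord id); exists (fun n => if n is n'.+1 then if n' is 0%N then (fun=> 1) else (fun=> 0) else id).
split=> // -[|[|n]] x; first exact: is_derive_id.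
- exact: is_derive_cst.
- exact: is_derive_cst.
Qed.

Lemma polyfun_smooth f : polyfun f -> smooth f.
Proof.
elim=> {f} [c|i|f g _ sf _ sg|f g _ sf _ sg].
- exact: smooth_cst.
- exact: smooth_coord.
- exact: smoothD.
- exact: smoothM.
Qed.

End Smooth.
End PartialDerivatives.

(** * Integrals over the unit interval depending on a parameter *)

Section UnitIntegral.
Context {R : realType}.
Implicit Types (f g F : R -> R).

Definition I01 f : R := (\int[lebesgue_measure]_(x in `[0%R, 1%R]) f x)%R.

Lemma I01_integrable f : continuous f ->
  (@lebesgue_measure R).-integrable `[0%R, 1%R] (EFin \o f).
Proof.
move=> cf; apply: continuous_compact_integrable; first exact: segment_compact.
exact: continuous_subspaceT.
Qed.

Lemma I01B f g : continuous f -> continuous g ->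
  I01 (fun t => f t - g t) = I01 f - I01 g.
Proof. by move=> cf cg; rewrite /I01 RintegralB// I01_integrable. Qed.

Lemma I01Z c f : continuous f -> I01 (fun t => c * f t) = c * I01 f.
Proof. by move=> cf; rewrite /I01 RintegralZl// I01_integrable. Qed.

Lemma I01_cst c : I01 (fun=> c) = c.
Proof.
rewrite /I01 Rintegral_cst//= lebesgue_measure_itv /= lte_fin ltr01.
by rewrite oppr0 adde0 /= mulr1.
Qed.

Lemma le_I01 f g : continuous f -> continuous g ->
  (forall t, 0 <= t <= 1 -> f t <= g t) -> I01 f <= I01 g.
Proof. by move=> cf cg fg; apply: le_Rintegral; rewrite ?I01_integrable. Qed.

Lemma I01_bound f e : continuous f -> (forall t, 0 <= t <= 1 -> `|f t| <= e) ->
  `|I01 f| <= e.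
Proof.
move=> cf fe; have ce c : continuous (fun _ : R => c : R) by exact: cst_continuous.
rewrite ler_norml -{1}(I01_cst (- e)) -{2}(I01_cst e); apply/andP; split; apply: le_I01 => // t /fe.
  by rewrite ler_norml => /andP[].
by rewrite ler_norml => /andP[].
Qed.

Lemma I01_FTC F f : continuous f -> (forall t : R, is_derive t 1 F (f t)) ->
  I01 f = F 1 - F 0.
Proof.
move=> cf dF; rewrite /I01 /Rintegral.
have cF : continuous F.
  by move=> t; apply/differentiable_continuous/derivable1_diffP; have [] := dF t.
rewrite (@continuous_FTC2 _ f F)//.
- exact: continuous_subspaceT.
- split; first by move=> t _; have [] := dF t.
    by apply: cvg_at_right_filter; exact: cF.
  by apply: cvg_at_left_filter; exact: cF.
- by move=> t _; rewrite derive1E; have [_ ->] := dF t.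
Qed.

(** A tube lemma for the compact segment. Half of [e] pays for moving [(t, y)] to [(t0, y0)], the
    other half for moving [(t, y0)] there. *)
Lemma unif_near (Y : topologicalType) (G : R -> Y -> R) y0 e : 0 < e ->
  continuous (fun p : R * Y => G p.1 p.2) ->
  \forall y \near y0, forall t, 0 <= t <= 1 -> `|G t y - G t y0| < e.
Proof.
move=> e0 cG.
have /compact_near_coveringP := @segment_compact R 0 1.
move=> /(_ Y (nbhs y0) (fun y t => `|G t y - G t y0| < e) _) H.
have {}H : \forall y \near y0, `[0, 1] `<=` (fun t => `|G t y - G t y0| < e).
  apply: H => t0 _; have e2 : 0 < e / 2 by rewrite divr_gt0.
  have /cvgrPdist_lt /(_ _ e2) := cG (t0, y0) => Hn.
  have cG2 : continuous (fun p : R * Y => G p.1 y0).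
    move=> p; apply: (@continuous2_cvg _ _ _ _ _ _ _ _ G); [exact: (cG (_, _))| |].
      exact: cvg_fst.
    exact: cvg_cst.
  have /cvgrPdist_lt /(_ _ e2) H2 := cG2 (t0, y0).
  apply: filterS2 Hn H2 => -[t y] /= A B.
  rewrite (splitr e) (le_lt_trans _ (ltrD A B))//.
  by rewrite (le_trans (ler_distD (G t0 y0) _ _))// lerD// distrC.
apply: filterS H => y Hy t t01; apply: Hy.
by rewrite /= in_itv.
Qed.

Lemma cont_param (Y : topologicalType) (G : R -> Y -> R) :
  continuous (fun p : R * Y => G p.1 p.2) -> continuous (fun y => I01 (G ^~ y)).
Proof.
move=> cG y0; apply/cvgrPdist_le => e e0.
have cGy y : continuous (G ^~ y).
  move=> t; apply: (@continuous2_cvg _ _ _ _ _ _ _ _ G); [exact: (cG (_, _))| |].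
    exact: cvg_id.
  exact: cvg_cst.
near=> y; rewrite -I01B//; apply: I01_bound.
  by move=> t; apply: cvgB; exact: cGy.
move=> t t01; rewrite distrC ltW//; move: t t01; near: y.
exact: unif_near.
Unshelve. all: end_near. Qed.

End UnitIntegral.

(** * Hadamard's lemma and Taylor expansion *)

Section Hadamard.
Context {R : realType}.

Lemma is_derive_shift_arg (F : R -> R) (s d : R) :
  is_derive (0 : R) 1 (fun h => F (h + s)) d -> is_derive s 1 F d.
Proof.
move=> H; rewrite (_ : F = (fun h => F (h + s)) \o (fun x => - s + x * 1)).
  rewrite -[d]mulr1; apply: (@is_derive1_comp _ (fun h => F (h + s))).
    by rewrite mulr1 addNr.
  exact: is_derive_affine.
by apply/funext => x /=; rewrite mulr1 addrAC addNr add0r.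
Qed.

(** Differentiation under the integral sign: by the mean value theorem the difference quotient is
    [dG t c] with [c] as close to 0 as [h], and [unif_near] compares it with [dG t 0] uniformly in
    [t]. *)
Lemma deriv_param (G dG : R -> R -> R) :
  (forall t (u : R), is_derive u 1 (G t) (dG t u)) ->
  continuous (fun p : R * R => G p.1 p.2) ->
  continuous (fun p : R * R => dG p.1 p.2) ->
  is_derive (0 : R) 1 (fun u => I01 (G ^~ u)) (I01 (dG ^~ 0)).
Proof.
move=> DG cG cdG.
have cGt (H : R -> R -> R) : continuous (fun p : R * R => H p.1 p.2) -> forall u, continuous (H ^~ u).
  move=> cH u t; apply: (@continuous2_cvg _ _ _ _ _ _ _ _ H); [exact: (cH (_, _))|exact: cvg_id|exact: cvg_cst].
have cv : h^-1 *: (((fun u => I01 (G ^~ u)) \o +%R^~ 0) (h *: (1 : R)) - I01 (G ^~ 0)) @[h --> 0^'] --> I01 (dG ^~ 0).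
  apply/cvgrPdist_le => e e0.
  have /nbhs_ballP [d /= d0 Hd] := unif_near _ dG 0 e e0 cdG.
  near=> h; have h0 : h != 0 by near: h; exact: nbhs_dnbhs_neq.
  have hd : `|h| < d.
    near: h; apply: nbhs_dnbhs; apply/nbhs_ballP; exists d => //= x.
    by rewrite /ball /= sub0r normrN.
  rewrite /= addr0 [_%:A]mulr1 -I01B; [|exact: cGt..].
  rewrite /GRing.scale /= -I01Z; last by move=> t; apply: cvgB; exact: cGt.
  rewrite -I01B; [|exact: cGt|]; last first.
    by move=> t; apply: cvgM; [exact: cvg_cst|apply: cvgB; exact: cGt].
  apply: I01_bound.
    move=> t; apply: cvgB; first exact: cGt.
    by apply: cvgM; [exact: cvg_cst|apply: cvgB; exact: cGt].
  move=> t t01.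
  have [c cd ->] : exists2 c, `|c| < d & G t h - G t 0 = dG t c * h.
    have cGu : continuous (G t).
      by move=> u; apply/differentiable_continuous/derivable1_diffP; have [] := DG t u.
    have [hp|hn|h00] := ltgtP 0 h; last by rewrite -h00 eqxx in h0.
      have [c] := MVT hp (fun x _ => DG t x) (@continuous_subspaceT _ _ _ _ cGu); rewrite in_itv /= => /andP[c0 ch] E; exists c; last by rewrite E subr0.
      by rewrite gtr0_norm// (lt_trans ch)//; rewrite gtr0_norm in hd.
    have [c] := MVT hn (fun x _ => DG t x) (@continuous_subspaceT _ _ _ _ cGu); rewrite in_itv /= => /andP[ch c0] E; exists c.
      rewrite ltr0_norm// (le_lt_trans _ hd)// ltr0_norm// lerN2 ltW//.
    by rewrite -opprB E sub0r mulrN opprK.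
  rewrite mulrC mulfK// distrC ltW//; apply: Hd => //.
  by rewrite /ball /= sub0r normrN.
apply: DeriveDef; first by apply/cvg_ex; exists (I01 (dG ^~ 0)).
exact: cvg_lim.
Unshelve. all: end_near. Qed.

Context {m : nat}.
Notation V := 'rV[R]_m.
Implicit Types (phi : V -> R) (y w : V) (i j : 'I_m).

(** Only the [i]-th coordinate moves: [t = 1] leaves [y] in place, [t = 0] replaces [y_i] by [a_i].
    A straight path from [a] to [y] would require a chain rule in several variables, whereas along
    an axis partial derivatives are enough. *)
Definition contract (a : V) i (t : R) y : V :=
  y + ((1 - t) * (a ord0 i - y ord0 i)) *: delta_mx ord0 i.

Lemma contract_along a i t j (h : R) y :
  contract a i t (h *: delta_mx ord0 j + y) =
  (h * (if i == j then t else 1)) *: delta_mx ord0 j + contract a i t y.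
Proof.
rewrite /contract coord_along; apply/rowP => k; rewrite !mxE /=.
by have [->|_] := eqVneq i j; [case: eqVneq => _ /=|]; rewrite ?mulr1n ?mulr0n; ring.
Qed.

Lemma contract1 a i y : contract a i 1 y = y.
Proof. by rewrite /contract subrr mul0r scale0r addr0. Qed.

Lemma contract_line a i t y : contract a i t y =
  (t * (y ord0 i - a ord0 i)) *: delta_mx ord0 i + contract a i 0 y.
Proof.
by rewrite /contract subr0 addrCA -scalerDl; congr (_ + _ *: _); ring.
Qed.

Lemma contract_continuous a i : continuous (fun p : R * V => contract a i p.1 p.2).
Proof.
move=> p; apply: cvgD; first exact: cvg_snd.
apply: cvgZr_tmp.
apply: cvgM; first by apply: cvgB; [exact: cvg_cst|exact: cvg_fst].
apply: cvgB; first exact: cvg_cst.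
apply: (@continuous_comp _ _ _ snd (fun y : V => y ord0 i)); first exact: cvg_snd.
exact: coord_continuous.
Qed.

Lemma is_derive_along phi j y (s : R) : smooth phi ->
  is_derive s 1 (fun u => phi (u *: delta_mx ord0 j + y))
    (pderiv j phi (s *: delta_mx ord0 j + y)).
Proof.
move=> sp; apply: is_derive_shift_arg.
under eq_fun do rewrite scalerDl -addrA.
apply/is_derive_lineP; apply: DeriveDef => //; exact: smooth_derivable.
Qed.

(** The weight [t ^+ k] serves closure under differentiation: [contract a i t] scales the [i]-th
    direction by [t], so a derivative in that direction raises the exponent by one, and the others
    leave it unchanged. *)
Definition Jint a i k phi y := I01 (fun t => t ^+ k * phi (contract a i t y)).

Lemma Jint_pderiv a i k phi j y : smooth phi ->
  is_derive y (delta_mx ord0 j) (Jint a i k phi) (Jint a i (k + (i == j)) (pderiv j phi) y).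
Proof.
move=> sp; apply/is_derive_lineP; rewrite /Jint.
pose c t : R := if i == j then t else 1.
pose G t u := t ^+ k * phi ((u * c t) *: delta_mx ord0 j + contract a i t y).
pose dG t u := t ^+ k * (pderiv j phi ((u * c t) *: delta_mx ord0 j + contract a i t y) * c t).
have -> : (fun h => I01 (fun t => t ^+ k * phi (contract a i t (h *: delta_mx ord0 j + y)))) =
    (fun u => I01 (G ^~ u)).
  by apply/funext => u; congr I01; apply/funext => t; rewrite contract_along.
have -> : (fun t => t ^+ (k + (i == j)) * pderiv j phi (contract a i t y)) = dG ^~ 0.
  apply/funext => t; rewrite /dG mul0r scale0r add0r [_ * c t]mulrC mulrA /c exprD.
  by case: (i == j); rewrite ?expr1 ?expr0.
have cc : continuous (fun p : R * R => c p.1).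
  rewrite /c; case: (i == j) => p; [exact: cvg_fst|exact: cvg_cst].
have cp : continuous (fun p : R * R => (p.2 * c p.1) *: (delta_mx ord0 j : V) + contract a i p.1 y).
  move=> p; apply: cvgD.
    apply: cvgZr_tmp.
    by apply: cvgM; [exact: cvg_snd|exact: cc].
  apply: (@continuous2_cvg _ _ _ _ _ _ _ _ (contract a i)); [exact: (contract_continuous a i (_, _))|exact: cvg_fst|exact: cvg_cst].
have ck : continuous (fun p : R * R => p.1 ^+ k).
  by move=> p; apply: (@continuous_comp _ _ _ fst (fun t : R => t ^+ k)); [exact: cvg_fst|exact: exprn_continuous].
apply: deriv_param.
- move=> t u; rewrite /G /dG.
  have Dc : is_derive u (1 : R) (fun u => u * c t) (c t).
    by have := is_derive_affine 0 (c t) u; under eq_fun do rewrite add0r.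
  have D := @is_derive1_comp _ _ (fun u => u * c t) u _ _ (is_derive_along phi j (contract a i t y) (u * c t) sp) Dc.
  exact: (@is_deriveZ R R R _ (t ^+ k) _ _ _ D).
- move=> p; apply: cvgM; first exact: ck.
  by apply: continuous_comp; [exact: cp|exact: smooth_continuous].
- move=> p; apply: cvgM; first exact: ck.
  apply: cvgM; last exact: cc.
  by apply: continuous_comp; [exact: cp|exact/smooth_continuous/smooth_pderiv].
Qed.

Lemma Jint_smooth a i k phi : smooth phi -> smooth (Jint a i k phi).
Proof.
move=> sp; pose C : set (V -> R) := [set f | exists k psi, smooth psi /\ f = Jint a i k psi].
apply: (good_class_smooth C); last by exists k, phi.
move=> _ [l [psi [spsi ->]]]; split.
  apply: (cont_param V (fun t y => t ^+ l * psi (contract a i t y))) => p.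
  apply: cvgM.
    by apply: (@continuous_comp _ _ _ fst (fun t : R => t ^+ l)); [exact: cvg_fst|exact: exprn_continuous].
  by apply: continuous_comp; [exact: (contract_continuous a i p)|exact: smooth_continuous].
move=> j; split; first by move=> y; have [] := Jint_pderiv a i l psi j y spsi.
exists (l + (i == j))%N, (pderiv j psi); split; first exact: smooth_pderiv.
by apply/funext => y; have [_] := Jint_pderiv a i l psi j y spsi.
Qed.

Lemma contract0_smooth a i phi : smooth phi -> smooth (phi \o contract a i 0).
Proof.
move=> sp; pose C : set (V -> R) := [set f | exists psi, smooth psi /\ f = psi \o contract a i 0].
apply: (alg_smooth C); last by apply: alg_base; exists phi.
move=> _ [psi [spsi ->]]; split.
  move=> y; apply: continuous_comp; last exact: smooth_continuous.
  by apply: (@continuous2_cvg V R V V (nbhs y) _ (fun=> 0) id (contract a i) 0 y);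
    [exact: (contract_continuous a i (0, y))|exact: cvg_cst|exact: cvg_id].
move=> j; pose c : R := if i == j then 0 else 1.
have D y : is_derive y (delta_mx ord0 j) (psi \o contract a i 0) (pderiv j psi (contract a i 0 y) * c).
  apply/is_derive_lineP => /=; under eq_fun do rewrite contract_along.
  have Dc : is_derive (0 : R) (1 : R) (fun u => u * c) c.
    by have := is_derive_affine 0 c 0; under eq_fun do rewrite add0r.
  have := @is_derive1_comp _ _ (fun u => u * c) 0 _ _ (is_derive_along psi j (contract a i 0 y) (0 * c) spsi) Dc.
  by rewrite mul0r scale0r add0r.
split; first by move=> y; have [] := D y.
rewrite (_ : pderiv j _ = fun y => (pderiv j psi \o contract a i 0) y * c).
  apply: alg_mul; last exact: alg_cst.
  apply: alg_base; exists (pderiv j psi); split; last by [].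
  exact: (smooth_pderiv _ j spsi).
by apply/funext => y; have [_] := D y.
Qed.

(** The fundamental theorem of calculus along the [i]-th axis, from [contract a i 0 y] to [y]. *)
Lemma hadamard_coord a i phi : smooth phi -> exists psi, smooth psi /\
  forall y, phi y = phi (contract a i 0 y) + (y ord0 i - a ord0 i) * psi y.
Proof.
move=> sp; exists (Jint a i 0 (pderiv i phi)); split; first exact/Jint_smooth/smooth_pderiv.
move=> y; set c := y ord0 i - a ord0 i.
pose F (t : R) := phi ((t * c) *: delta_mx ord0 i + contract a i 0 y).
pose f (t : R) := pderiv i phi ((t * c) *: delta_mx ord0 i + contract a i 0 y).
have dF (t : R) : is_derive t 1 F (c * f t).
  have Dc : is_derive t (1 : R) (fun u => u * c) c.
    by have := is_derive_affine 0 c t; under eq_fun do rewrite add0r.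
  rewrite mulrC.
  exact: (@is_derive1_comp _ _ (fun u => u * c) t _ _ (is_derive_along phi i (contract a i 0 y) (t * c) sp) Dc).
have cf : continuous f.
  move=> t; apply: continuous_comp; last exact/smooth_continuous/smooth_pderiv.
  apply: cvgD; last exact: cvg_cst.
  apply: cvgZr_tmp; apply: cvgM; [exact: cvg_id|exact: cvg_cst].
have := I01_FTC F (fun t => c * f t) _ dF.
rewrite I01Z// => H; rewrite /Jint.
have -> : (fun t => t ^+ 0 * pderiv i phi (contract a i t y)) = f.
  by apply/funext => t; rewrite expr0 mul1r /f -contract_line.
rewrite H /F; last by move=> t; apply: cvgM; [exact: cvg_cst|exact: cf].
rewrite -contract_line contract1 mul0r scale0r add0r; ring.
Qed.

Theorem hadamard a phi : smooth phi -> exists psi : 'I_m -> V -> R,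
  (forall i, smooth (psi i)) /\
  forall y, phi y = phi a + \sum_i (y ord0 i - a ord0 i) * psi i y.
Proof.
move=> sp.
have H (s : seq 'I_m) : forall phi, smooth phi -> exists psi : 'I_m -> V -> R, (forall i, smooth (psi i)) /\
    forall y, phi y = phi (\row_i (if i \in s then a ord0 i else y ord0 i)) +
      \sum_i (y ord0 i - a ord0 i) * psi i y.
  elim: s => [|i s IH] {sp}phi sp.
    exists (fun _ _ => 0); split=> [i|y]; first exact: smooth_cst.
    rewrite big1 ?addr0; last by move=> i _; rewrite mulr0.
    by congr phi; apply/rowP => i; rewrite mxE.
  have [psi0 [spsi0 E0]] := hadamard_coord a i phi sp.
  have [psi [spsi E]] := IH _ (contract0_smooth a i phi sp).
  (* [psi0] is added to the [i]-th coefficient rather than put in its place: the list may repeat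
     [i], so that this coefficient may already carry a term. *)
  exists (fun k y => psi k y + (i == k)%:R * psi0 y); split=> [k|y].
    exact: (smoothD _ _ (spsi k) (smoothZ _ _ spsi0)).
  rewrite E0 [phi (contract _ _ _ _)]E /= -addrA; congr (_ + _).
    congr phi; apply/rowP => k; rewrite !mxE inE eq_refl /= subr0 mul1r eq_sym.
    case: eqVneq => [<-|_]; last by rewrite mulr0 addr0.
    by rewrite mulr1 addrCA subrr addr0.
  under [RHS]eq_bigr do rewrite mulrDr.
  rewrite big_split /=; congr (_ + _).
  rewrite (bigD1 i)//= eqxx mul1r big1 ?addr0// => k ki.
  by rewrite eq_sym (negbTE ki) mul0r mulr0.
have [psi [spsi E]] := H (enum 'I_m) phi sp; exists psi; split => // y; rewrite E.
by congr (phi _ + _); apply/rowP => i; rewrite mxE mem_enum.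
Qed.

End Hadamard.

Section Taylor.
Context {R : realType} {m : nat}.
Notation V := 'rV[R]_m.
Implicit Types (phi : V -> R) (a v w y : V) (i j k : 'I_m).

(** The difference quotient is [Psi h] itself, so continuity at 0 suffices. This reads the
    derivatives of [phi] off Hadamard's formula without differentiating its coefficients. *)
Lemma is_derive0_mul (Psi : R -> R) (c : R) : {for 0, continuous Psi} ->
  is_derive (0 : R) 1 (fun h => c + h * Psi h) (Psi 0).
Proof.
move=> cP.
have cv : h^-1 *: (((fun h => c + h * Psi h) \o +%R^~ 0) (h *: (1 : R)) - (c + 0 * Psi 0)) @[h --> 0^'] --> Psi 0.
  apply: (@cvg_trans _ (Psi @ 0^')); last exact: cvg_within_filter.
  apply: near_eq_cvg; near=> h => /=.
  have h0 : h != 0 by near: h; exact: nbhs_dnbhs_neq.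
  by rewrite addr0 [_%:A]mulr1 mul0r addr0 addrAC subrr add0r /GRing.scale /= mulKf.
by apply: DeriveDef; [apply/cvg_ex; exists (Psi 0)|exact: cvg_lim].
Unshelve. all: end_near. Qed.

Lemma smooth_sum_hadamard_is_derive phi a w (psi : 'I_m -> V -> R) :
  (forall i, smooth (psi i)) ->
  (forall y, phi y = phi a + \sum_i (y ord0 i - a ord0 i) * psi i y) ->
  is_derive a w phi (\sum_i w ord0 i * psi i a).
Proof.
move=> spsi E; apply/is_derive_lineP.
pose Psi (h : R) := \sum_i w ord0 i * psi i (h *: w + a).
have -> : (fun h => phi (h *: w + a)) = (fun h => phi a + h * Psi h).
  apply/funext => h; rewrite E; congr (_ + _); rewrite mulr_sumr; apply: eq_bigr => i _.
  by rewrite !mxE addrK mulrA.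
have -> : \sum_i w ord0 i * psi i a = Psi 0.
  by apply: eq_bigr => i _; rewrite scale0r add0r.
apply: is_derive0_mul.
have sP : smooth (fun v => \sum_i w ord0 i * psi i v).
  by apply: smooth_sum => i; exact: smoothZ.
apply: (@continuous_comp _ _ _ (fun h : R => h *: w + a) (fun v => \sum_i w ord0 i * psi i v)).
  by apply: cvgD; [apply: cvgZr_tmp; exact: cvg_id|exact: cvg_cst].
exact: smooth_continuous.
Qed.

Lemma hadamard_coef phi a (psi : 'I_m -> V -> R) :
  (forall i, smooth (psi i)) ->
  (forall y, phi y = phi a + \sum_i (y ord0 i - a ord0 i) * psi i y) ->
  forall i, pderiv i phi a = psi i a.
Proof.
move=> spsi E i; have [_] := smooth_sum_hadamard_is_derive phi a (delta_mx ord0 i) psi spsi E.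
rewrite /pderiv => ->; rewrite (bigD1 i)//= mxE !eqxx mul1r big1 ?addr0// => k ki.
by rewrite mxE (negbTE ki) andbF mul0r.
Qed.

(** The definition of [smooth] only mentions the axes; the arbitrary direction [w] is reached
    because Hadamard's formula makes [phi (h *: w + a) - phi a] equal to [h] times a continuous
    function of [h]. *)
Lemma is_derive_smooth phi a w : smooth phi ->
  is_derive a w phi (\sum_i w ord0 i * pderiv i phi a).
Proof.
move=> sp; have [psi [spsi E]] := hadamard a phi sp.
apply: is_derive_eq; first exact: (smooth_sum_hadamard_is_derive phi a w psi spsi E).
by apply: eq_bigr => i _; rewrite (hadamard_coef phi a psi spsi E).
Qed.

Lemma pderiv_cst c i : pderiv i (fun _ : V => c : R) = fun=> 0.
Proof. by apply/funext => v; exact: derive_cst. Qed.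

Lemma pderiv_coord k i c : pderiv i (fun v : V => v ord0 k - c) = fun=> (k == i)%:R.
Proof.
apply/funext => v.
have D : is_derive (v ord0 k) (1 : R) (fun t => t - c) 1.
  have := is_derive_affine (- c) 1 (v ord0 k).
  by under eq_fun do rewrite mulr1 addrC.
by have [_] := is_derive_coord _ _ v k i D; rewrite mulr1.
Qed.

Lemma pderiv_sum i (F : 'I_m -> V -> R) : (forall k, smooth (F k)) ->
  pderiv i (fun v => \sum_k F k v) = fun v => \sum_k pderiv i (F k) v.
Proof.
move=> sF; elim: (index_enum _) => [|k r IH].
  under eq_fun do rewrite big_nil.
  by rewrite pderiv_cst; apply/funext => v; rewrite big_nil.
under eq_fun do rewrite big_cons.
have sr : smooth (fun v => \sum_(j <- r) F j v) by exact: smooth_sum.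
rewrite (pderivD _ _ _ (fun v => smooth_derivable _ v i (sF k)) (fun v => smooth_derivable _ v i sr)).
by rewrite IH; apply/funext => v; rewrite big_cons.
Qed.

Lemma smooth_coordB k c : smooth (fun v : V => v ord0 k - c).
Proof. by apply: smoothB; [exact: smooth_coord|exact: smooth_cst]. Qed.

Lemma pderiv_hadamard_sum a i (F : 'I_m -> V -> R) : (forall k, smooth (F k)) ->
  pderiv i (fun v => \sum_k (v ord0 k - a ord0 k) * F k v) =
  (fun v => F i v + \sum_k (v ord0 k - a ord0 k) * pderiv i (F k) v).
Proof.
move=> sF; rewrite pderiv_sum; last by move=> k; apply: smoothM => //; exact: smooth_coordB.
apply/funext => v; rewrite -[F i v]mul1r (bigD1 i)//= [in RHS](bigD1 i)//= addrA.
have E k : pderiv i (fun v => (v ord0 k - a ord0 k) * F k v) v =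
    (k == i)%:R * F k v + (v ord0 k - a ord0 k) * pderiv i (F k) v.
  have sB := smooth_coordB k (a ord0 k).
  rewrite (pderivM _ _ _ (fun w => smooth_derivable _ w i sB) (fun w => smooth_derivable _ w i (sF k))).
  by rewrite pderiv_coord.
rewrite E eqxx; congr (_ + _); apply: eq_bigr => k ki.
by rewrite E (negbTE ki) mul0r add0r.
Qed.

(** Hadamard's formula is differentiated twice; at [a] every term that still has a factor
    [y_k - a_k] drops out. The result is symmetric in [i] and [j], so mixed partial derivatives
    commute as a by-product. *)
Lemma hadamard_coef2 phi a (psi : 'I_m -> V -> R) :
  (forall i, smooth (psi i)) ->
  (forall y, phi y = phi a + \sum_i (y ord0 i - a ord0 i) * psi i y) ->
  forall i j, pderiv j (pderiv i phi) a = pderiv j (psi i) a + pderiv i (psi j) a.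
Proof.
move=> spsi E i j.
have s1 k : smooth (fun y => (y ord0 k - a ord0 k) * psi k y).
  by apply: smoothM => //; exact: smooth_coordB.
have s2 k : smooth (fun y => (y ord0 k - a ord0 k) * pderiv i (psi k) y).
  by apply: smoothM; [exact: smooth_coordB|exact: smooth_pderiv].
have sc : smooth (fun _ : V => phi a) by exact: smooth_cst.
have ss1 := smooth_sum _ (index_enum 'I_m) _ s1.
have ss2 := smooth_sum _ (index_enum 'I_m) _ s2.
rewrite (funext E : phi = _).
rewrite (pderivD _ _ _ (fun v => smooth_derivable _ v i sc) (fun v => smooth_derivable _ v i ss1)).
rewrite pderiv_cst pderiv_hadamard_sum//; under eq_fun do rewrite add0r.
rewrite (pderivD _ _ _ (fun v => smooth_derivable _ v j (spsi i)) (fun v => smooth_derivable _ v j ss2)).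
rewrite (pderiv_hadamard_sum _ _ _ (fun k => smooth_pderiv _ i (spsi k))).
by rewrite big1 ?addr0// => k _; rewrite subrr mul0r.
Qed.

(* The coefficients [b] need not be symmetric; only their symmetrization is
   determined by [phi]. *)
Theorem taylor3 phi a : smooth phi -> exists (b : 'I_m -> 'I_m -> R)
    (psi : 'I_m -> 'I_m -> 'I_m -> V -> R),
  [/\ forall i j k, smooth (psi i j k),
    forall i j, pderiv j (pderiv i phi) a = b i j + b j i &
    forall y, phi y = phi a + \sum_i (y ord0 i - a ord0 i) * pderiv i phi a
      + \sum_i \sum_j (y ord0 i - a ord0 i) * (y ord0 j - a ord0 j) * b i j
      + \sum_i \sum_j \sum_k (y ord0 i - a ord0 i) * (y ord0 j - a ord0 j) *
          ((y ord0 k - a ord0 k) * psi i j k y)].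
Proof.
move=> sp; have [p1 [sp1 E1]] := hadamard a phi sp.
have /choice [p2 H2] : forall i, exists psi : 'I_m -> V -> R, (forall j, smooth (psi j)) /\
  forall y, p1 i y = p1 i a + \sum_j (y ord0 j - a ord0 j) * psi j y.
  by move=> i; exact: (hadamard a _ (sp1 i)).
(* Hadamard's lemma for the third time, on the coefficients of the coefficients. The values
   [p2 i j a] are the [b i j] below, by [hadamard_coef]. *)
have /choice [p3 H3] : forall ij : 'I_m * 'I_m, exists psi : 'I_m -> V -> R, (forall k, smooth (psi k)) /\
  forall y, p2 ij.1 ij.2 y = p2 ij.1 ij.2 a + \sum_k (y ord0 k - a ord0 k) * psi k y.
  by move=> ij; exact: (hadamard a _ (proj1 (H2 ij.1) ij.2)).
exists (fun i j => pderiv j (p1 i) a), (fun i j => p3 (i, j)); split.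
- by move=> i j k; have [] := H3 (i, j).
- exact: hadamard_coef2.
move=> y; rewrite {1}E1 -!addrA; congr (_ + _).
rewrite -!big_split /=; apply: eq_bigr => i _.
have [s2 E2] := H2 i; rewrite (hadamard_coef phi a p1)// {1}E2 mulrDr; congr (_ + _).
rewrite mulr_sumr -big_split /=; apply: eq_bigr => j _.
have [s3 E3] := H3 (i, j); rewrite {1}E3 /= (hadamard_coef (p1 i) a (p2 i))//.
rewrite mulrA mulrDr; congr (_ + _); rewrite mulr_sumr; apply: eq_bigr => k _.
by [].
Qed.

End Taylor.

(** * Cut-off functions *)

Section Flat.
Context {R : realType}.

(** The classical flat function [exp (- 1 / t)] times powers of [1 / t]; the powers make the family,
    up to linear combinations, stable under differentiation. *)
Definition flat (k : nat) (t : R) : R := if 0 < t then t^-1 ^+ k * expR (- t^-1) else 0.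

Lemma flat_le0 k t : t <= 0 -> flat k t = 0.
Proof. by rewrite /flat leNgt => /negbTE ->. Qed.

Lemma flat_gt0 k t : 0 < t -> flat k t = t^-1 ^+ k * expR (- t^-1).
Proof. by rewrite /flat => ->. Qed.

(** With [s = 1 / t], the exponential series gives [exp s >= s ^ (k + 2) / (k + 2)!]. The quadratic
    order forces the derivative at 0 to vanish. *)
Lemma flat_bound k t : 0 <= flat k t <= (k.+2)`!%:R * t ^+ 2.
Proof.
have [t0|t0] := leP t 0; first by rewrite flat_le0// lexx mulr_ge0// exprn_even_ge0.
have s0 : 0 < t^-1 by rewrite invr_gt0.
rewrite flat_gt0//; apply/andP; split.
  by rewrite mulr_ge0 ?expR_ge0// exprn_ge0// ltW.
have := @expR_ge1Dxn R (t^-1) k.+1 (ltW s0).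
set N := _`!%:R; have N0 : 0 < N by rewrite ltr0n fact_gt0.
move=> H; rewrite expRN ler_pdivrMr ?expR_gt0//.
have {}H : t^-1 ^+ k.+2 <= expR t^-1 * N.
  by rewrite -ler_pdivrMr// (le_trans _ H)// lerDr.
rewrite -(@ler_pM2l _ (t^-1 ^+ 2)) ?exprn_gt0//.
rewrite -exprD add2n (le_trans H)//.
have -> : t^-1 ^+ 2 * (N * t ^+ 2 * expR t^-1) = (t^-1 * t) ^+ 2 * (expR t^-1 * N).
  by rewrite exprMn; ring.
by rewrite mulVf ?gt_eqF// expr1n mul1r.
Qed.

Lemma flat_is_derive k (t : R) :
  is_derive t 1 (flat k) (flat k.+2 t - k%:R * flat k.+1 t).
Proof.
have [t0|t0|->] := ltgtP t 0.
- rewrite !flat_le0 ?ltW// mulr0 subr0.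
  apply: (@near_eq_is_derive R R R (cst 0)).
  near=> x; rewrite flat_le0// ltW//; near: x; exact: lt_nbhsl.
- rewrite !flat_gt0//.
  apply: (@near_eq_is_derive R R R (fun x : R => x^-1 ^+ k * expR (- x^-1))).
    near=> x; rewrite flat_gt0//; near: x; exact: lt_nbhsr.
  have Di : is_derive t (1 : R) (fun x : R => x^-1) (- t^-1 ^+ 2).
    have t0' := lt0r_neq0 t0; have Did := is_derive_id t (1 : R).
    apply: DeriveDef; first by apply: derivableV => //; case: Did.
    rewrite deriveV//.
    by rewrite derive_id /GRing.scale /= mulr1 exprVn.
  have De : is_derive t (1 : R) (fun x => expR (- x^-1)) (expR (- t^-1) * t^-1 ^+ 2).
    have := @is_derive1_comp _ expR _ _ _ _ (is_derive_expR _) (is_deriveN Di).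
    by rewrite opprK.
  have Dk : is_derive t (1 : R) (fun x : R => x^-1 ^+ k) (k%:R * t^-1 ^+ k.-1 * - t^-1 ^+ 2).
    have := is_deriveX k Di.
    by rewrite exprfctE.
  apply: (is_derive_eq (is_deriveM Dk De)).
  rewrite /GRing.scale /=; case: k {Dk} => [|k] /=; first by rewrite !mul0r; ring.
  by rewrite !exprS; ring.
(* At 0 the difference quotient is at most [(k + 2)!] times [|h|]. *)
- rewrite !flat_le0// mulr0 subr0.
  have cv : h^-1 *: ((flat k \o +%R^~ 0) (h *: (1 : R)) - flat k 0) @[h --> 0^'] --> (0 : R).
    rewrite flat_le0//.
    apply/cvgrPdist_le => e e0; near=> h.
    have h0 : h != 0 by near: h; exact: nbhs_dnbhs_neq.
    rewrite /= addr0 [_%:A]mulr1 !subr0 sub0r normrN normrM normfV.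
    have /andP[f0 fh] := flat_bound k h.
    rewrite (ger0_norm f0) mulrC ler_pdivrMr ?normr_gt0//.
    rewrite (le_trans fh)//.
    have -> : h ^+ 2 = `|h| * `|h| by rewrite -normrM -expr2 ger0_norm// exprn_even_ge0.
    rewrite mulrA ler_wpM2r// mulrC -ler_pdivlMr ?ltr0n ?fact_gt0// ltW//.
    near: h; apply: nbhs_dnbhs; apply/nbhs_ballP.
    exists (e / (k.+2)`!%:R); first by rewrite /= divr_gt0// ltr0n fact_gt0.
    by move=> x; rewrite /ball /= sub0r normrN.
  by apply: DeriveDef; [apply/cvg_ex; exists 0|exact: cvg_lim].
Unshelve. all: end_near. Qed.

Context {m : nat}.
Notation V := 'rV[R]_m.
Implicit Types (f g : V -> R) (a v : V) (i : 'I_m).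

Lemma flat_smooth k b c i : smooth (fun v : V => flat k (b + v ord0 i * c)).
Proof.
pose C : set (V -> R) := [set f | exists k, f = fun v => flat k (b + v ord0 i * c)].
apply: (alg_smooth C); last by apply: alg_base; exists k.
move=> _ [l ->].
pose dh (x : R) : R := (flat l.+2 (b + x * c) + - l%:R * flat l.+1 (b + x * c)) * c.
have D v j : is_derive v (delta_mx ord0 j) (fun v : V => flat l (b + v ord0 i * c))
    ((i == j)%:R * dh (v ord0 i)).
  apply: (is_derive_coord (fun x => flat l (b + x * c))).
  rewrite /dh mulNr.
  exact: (@is_derive1_comp _ (flat l) (fun x => b + x * c) _ _ _ (flat_is_derive _ _) (is_derive_affine _ _ _)).
split.
  move=> v; apply: (@continuous_comp _ _ _ (fun v : V => v ord0 i) (fun x => flat l (b + x * c))).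
    exact: coord_continuous.
  apply/differentiable_continuous/derivable1_diffP.
  have [] := @is_derive1_comp _ (flat l) (fun x => b + x * c) _ _ _ (flat_is_derive _ _) (is_derive_affine b c (v ord0 i)).
  by [].
move=> j; split; first by move=> v; have [] := D v j.
rewrite (_ : pderiv j _ = fun v => (i == j)%:R * dh (v ord0 i)); last first.
  by apply/funext => v; have [_] := D v j.
apply: alg_mul; first exact: alg_cst.
apply: alg_mul; last exact: alg_cst.
apply: alg_add; first by apply: alg_base; exists l.+2.
by apply: alg_mul; [exact: alg_cst|apply: alg_base; exists l.+1].
Qed.

(** The generators include all smooth functions besides [exp f], as the derivative of the latter is
    [exp f] times a smooth function. *)
Lemma expR_smooth f : smooth f -> smooth (fun v => expR (f v)).
Proof.
move=> sf; pose C : set (V -> R) := [set g | g = (fun v => expR (f v)) \/ smooth g].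
apply: (alg_smooth C); last by apply: alg_base; left.
have D v j : is_derive v (delta_mx ord0 j) (fun v : V => expR (f v))
    (expR (f v) * pderiv j f v).
  apply/is_derive_lineP.
  have := is_derive_along f j v 0 sf; rewrite scale0r add0r => Df.
  have := @is_derive1_comp _ expR _ _ _ _ (is_derive_expR _) Df.
  by rewrite /= scale0r add0r.
move=> g [->|sg]; last first.
  have [cg dg] := smooth_good _ sg; split=> // j; have [d s] := dg j; split => //.
  by apply: alg_base; right.
split.
  move=> v; apply: continuous_comp; last exact: continuous_expR.
  exact: smooth_continuous.
move=> j; split; first by move=> v; have [] := D v j.
rewrite (_ : pderiv j _ = fun v => expR (f v) * pderiv j f v); last first.
  by apply/funext => v; have [_] := D v j.
apply: alg_mul; first by apply: alg_base; left.
by apply: alg_base; right; exact: smooth_pderiv.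
Qed.

Lemma row_norm_gt (r : R) v : 0 <= r -> r < `|v| -> exists i, r < `|v ord0 i|.
Proof.
move=> r0 rv.
have /mx_norm_neq0 [[i0 i] /= E] : mx_norm v != 0.
  by rewrite gt_eqF// (le_lt_trans r0 rv).
by exists i; rewrite (ord1 i0) in E; rewrite -E.
Qed.

(** Unlike [C0inf], this class absorbs products with arbitrary smooth functions, polynomials in
    particular. *)
Definition csupp f := smooth f /\ exists r : R, forall v, r < `|v| -> f v = 0.

Lemma csuppM f g : smooth f -> csupp g -> csupp (fun v => f v * g v).
Proof.
move=> sf [sg [r Hr]]; split; first exact: smoothM.
by exists r => v /Hr ->; rewrite mulr0.
Qed.

Lemma csupp_C0inf f : csupp f -> C0inf f.
Proof.
by move=> [sf [r Hr]]; split => // e e0; exists r => v /Hr ->; rewrite normr0.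
Qed.

Lemma exists_bump a : exists chi, csupp chi /\ chi a = 1.
Proof.
(* The arguments are [1 + (v_i - a_i)] and [1 - (v_i - a_i)]: the product vanishes once
   [|v_i - a_i| >= 1], and at [a] it is the square of [flat 0 1], hence the two factors [c^-1]
   below. *)
pose b i v := flat 0 ((1 - a ord0 i) + v ord0 i * 1) * flat 0 ((1 + a ord0 i) + v ord0 i * (-1)).
pose c : R := flat 0 1.
have c0 : c != 0 by rewrite /c flat_gt0// expr0 mul1r expR_eq0.
exists (fun v => \prod_i (c^-1 * c^-1 * b i v)); split; last first.
  apply: big1 => i _; rewrite /b mulr1 mulrN1 subrK addrK -/c.
  by rewrite mulrACA mulVf// mulr1.
split.
  apply: smooth_prod => i; apply: smoothZ; apply: smoothM; exact: flat_smooth.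
exists (`|a| + 1) => v /row_norm_gt [|i vi]; first by rewrite addr_ge0.
rewrite (bigD1 i)//= (_ : b i v = 0) ?mulr0 ?mul0r//.
have ai : `|a ord0 i| <= `|a|.
  rewrite [leRHS]/Num.norm /= mx_normrE.
  exact: (le_bigmax _ (fun ij => `|a ij.1 ij.2|) (ord0, i)).
have : 1 < `|v ord0 i - a ord0 i| by have := lerB_dist (v ord0 i) (a ord0 i); lra.
rewrite ltr_normr /b => /orP[] H; last by rewrite flat_le0 ?mul0r//; lra.
by rewrite [X in _ * X]flat_le0 ?mulr0//; lra.
Qed.

End Flat.

Section CutoffExp.
Context {R : realType}.

(** The correction vanishes on the negative half-line. On the positive one [flat 0] is bounded below
    away from 0, so the quadratic term eventually wins and the exponent tends to minus infinity. *)
Definition cutoff_exp (v : 'rV[R]_1) : R :=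
  expR (v ord0 ord0 - v ord0 ord0 ^+ 2 * flat 0 (v ord0 ord0)).

Lemma cutoff_expE (v : 'rV[R]_1) : v ord0 ord0 <= 0 -> cutoff_exp v = expR (v ord0 ord0).
Proof. by move=> v0; rewrite /cutoff_exp flat_le0// mulr0 subr0. Qed.

Lemma cutoff_exp_C0inf : C0inf cutoff_exp.
Proof.
split.
  apply: expR_smooth; apply: smoothB; first exact: smooth_coord.
  apply: smoothM; first by apply: smoothM; exact: smooth_coord.
  have := @flat_smooth R 1 0 0 1 ord0.
  by under eq_fun do rewrite add0r mulr1.
move=> e e0; set q := expR (-1 : R); have q0 : 0 < q by exact: expR_gt0.
(* For positive [v], the summand 1 ensures [flat 0 v >= q] and [2 / q] ensures [v * q >= 2], so that
   the exponent is at most [- |v|]; [e^-1] then gives [exp (- |v|) < e] through [exp x >= 1 + x]. *)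
exists (e^-1 + 2 / q + 1) => v /row_norm_gt [|i].
  have e1 : 0 <= e^-1 by rewrite invr_ge0 ltW.
  by have := divr_ge0 (ler0n R 2) (ltW q0); lra.
rewrite (ord1 i) /cutoff_exp; move: (v ord0 ord0) => {i} {}v Hv.
have ei : 0 < e^-1 by rewrite invr_gt0.
have qi : 0 < 2 / q by rewrite divr_gt0.
rewrite gtr0_norm ?expR_gt0//.
have Hle : v - v ^+ 2 * flat 0 v <= - `|v|.
  have [v0|v0] := leP v 0; first by rewrite flat_le0// mulr0 subr0 ler0_norm// opprK.
  rewrite gtr0_norm// in Hv *.
  have fq : q <= flat 0 v.
    rewrite flat_gt0// expr0 mul1r ler_expR lerN2 invf_le1//; lra.
  have v2 : 2 <= v * q by rewrite -ler_pdivrMr//; lra.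
  have : 2 * v <= v ^+ 2 * flat 0 v.
    have vf : v * q <= v * flat 0 v by rewrite ler_wpM2l// ltW.
    by rewrite expr2 -mulrA [2 * v]mulrC ler_wpM2l ?(ltW v0)// (le_trans v2).
  lra.
apply: (@le_lt_trans _ _ (expR (- `|v|))); first by rewrite ler_expR.
rewrite expRN invf_plt ?posrE ?expR_gt0//.
apply: lt_le_trans (expR_ge1Dx _); lra.
Qed.

End CutoffExp.

(** * The domain and its directional derivatives *)

Local Notation span := Defs.span.

Section Span.
Context {R : realType} {X : Type}.
Implicit Types (S : set (X -> R)) (f g : X -> R).

(** The step also provides [span S g], since linearity on a span can only be used for members of
    it. *)
Lemma span_ind S (P : (X -> R) -> Prop) :
  P (fun=> 0) -> (forall a f g, S f -> span S g -> P g -> P (fun x => a * f x + g x)) ->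
  forall f, span S f -> P f.
Proof.
move=> P0 PS f [n [c [fs [Sfs ->]]]].
suff H (r : seq 'I_n) : span S (fun x => \sum_(k <- r) c k * fs k x) /\ P (fun x => \sum_(k <- r) c k * fs k x).
  by have [] := H (index_enum _).
elim: r => [|k r [IH1 IH2]].
  under eq_fun do rewrite big_nil; split => //.
  exists 0%N, (fun _ => 0), (fun _ _ => 0); split => [[]//|].
  by apply/funext => x; rewrite big_ord0.
under eq_fun do rewrite big_cons; split; last exact: PS.
case: IH1 => l [d [gs [Sgs E]]].
exists l.+1, (fun i => if unlift ord0 i is Some j then d j else c k),
  (fun i => if unlift ord0 i is Some j then gs j else fs k); split.
  by move=> i; case: (unlift ord0 i).
apply/funext => x; rewrite big_ord_recl /= unlift_none; congr (_ + _).
have /(congr1 (@^~ x)) /= -> := E; apply: eq_bigr => i _.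
by rewrite liftK.
Qed.

Lemma span_linS S a f g : S f -> span S g -> span S (fun x => a * f x + g x).
Proof.
move=> Sf [l [d [gs [Sgs ->]]]].
exists l.+1, (fun i => if unlift ord0 i is Some j then d j else a),
  (fun i => if unlift ord0 i is Some j then gs j else f); split.
  by move=> i; case: (unlift ord0 i).
apply/funext => x; rewrite big_ord_recl /= unlift_none; congr (_ + _).
by apply: eq_bigr => i _; rewrite liftK.
Qed.

Lemma span0 S : span S (fun=> 0).
Proof.
exists 0%N, (fun _ => 0), (fun _ _ => 0); split => [[]//|].
by apply/funext => x; rewrite big_ord0.
Qed.

Lemma span_base S f : S f -> span S f.
Proof.
move=> Sf; rewrite (_ : f = fun x => 1 * f x + 0); first exact: (span_linS _ _ _ _ Sf (span0 S)).
by apply/funext => x; rewrite mul1r addr0.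
Qed.

Lemma span_lin S a f g : span S f -> span S g -> span S (fun x => a * f x + g x).
Proof.
move=> + Sg; apply: (span_ind S (fun f => span S (fun x => a * f x + g x))).
  by under eq_fun do rewrite mulr0 add0r.
move=> b h k Sh _ IH.
under eq_fun do rewrite mulrDr -addrA mulrA.
exact: span_linS.
Qed.

Definition lin_closed S := S (fun=> 0) /\
  forall a f g, S f -> S g -> S (fun x => a * f x + g x).

Lemma span_lin_closed S : lin_closed (span S).
Proof. by split; [exact: span0|exact: span_lin]. Qed.

Lemma lin_closed_sum S (I : Type) (r : seq I) (c : I -> R) (F : I -> X -> R) :
  lin_closed S -> (forall k, S (F k)) -> S (fun x => \sum_(k <- r) c k * F k x).
Proof.
move=> [S0 SL] SF; elim: r => [|k r IH].
  by under eq_fun do rewrite big_nil.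
by under eq_fun do rewrite big_cons; exact: SL.
Qed.

Lemma lin_on_fun0 (Y : Type) S (B : (X -> R) -> Y -> R) : lin_closed S -> lin_on_fun S B ->
  B (fun=> 0) = fun=> 0.
Proof.
move=> [S0 _] LB; have := LB (-1) _ _ S0 S0.
under [X in B X = _]eq_fun do rewrite mulr0 addr0.
by move=> ->; apply/funext => y; rewrite mulN1r addNr.
Qed.

Lemma lin_on_fun_sum (Y : Type) S (B : (X -> R) -> Y -> R) (I : Type) (r : seq I) (c : I -> R)
    (F : I -> X -> R) : lin_closed S -> lin_on_fun S B -> (forall k, S (F k)) ->
  B (fun x => \sum_(k <- r) c k * F k x) = fun y => \sum_(k <- r) c k * B (F k) y.
Proof.
move=> CS LB SF; elim: r => [|k r IH].
  under eq_fun do rewrite big_nil.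
  by rewrite (lin_on_fun0 _ _ _ CS LB); apply/funext => y; rewrite big_nil.
under eq_fun do rewrite big_cons.
rewrite LB//; last exact: lin_closed_sum.
by apply/funext => y; rewrite big_cons IH.
Qed.

(** A number is a function on a one-point type, so results on [lin_on_fun] carry over to
    functionals. *)
Lemma lin_on_R_fun S (B : (X -> R) -> R) : lin_on_R S B -> lin_on_fun S (fun f (_ : unit) => B f).
Proof. by move=> LB a f g Sf Sg; rewrite LB. Qed.

Lemma lin_on_R0 S (B : (X -> R) -> R) : lin_closed S -> lin_on_R S B -> B (fun=> 0) = 0.
Proof.
by move=> CS /lin_on_R_fun /(lin_on_fun0 _ _ _ CS) /(congr1 (@^~ tt)).
Qed.

Lemma lin_on_funZ (Y : Type) S (B : (X -> R) -> Y -> R) a f : lin_closed S -> lin_on_fun S B ->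
  S f -> B (fun x => a * f x) = fun y => a * B f y.
Proof.
move=> CS LB Sf; have := LB a f _ Sf (proj1 CS).
under eq_fun do rewrite addr0.
by move=> ->; rewrite (lin_on_fun0 _ _ _ CS LB); apply/funext => y; rewrite addr0.
Qed.

Lemma lin_on_RZ S (B : (X -> R) -> R) a f : lin_closed S -> lin_on_R S B ->
  S f -> B (fun x => a * f x) = a * B f.
Proof.
by move=> CS /lin_on_R_fun LB Sf; have /(congr1 (@^~ tt)) := lin_on_funZ _ _ _ a f CS LB Sf.
Qed.

End Span.

Section DirectionalDerivative.
Context {R : realType} {T : ptopologicalType}.
Implicit Types (f g : MM R T -> R) (nu : MM R T) (x : T).

(** The first clause lets the product rule be evaluated at [nu] instead of its shift by a zero mass;
    for cylinder functions it holds because [mint] then only gains a term [0 * g x]. *)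
Definition pd_derivable f := forall nu x,
  f (Defs.shift nu x 0) = f nu /\ derivable (fun e : R => f (Defs.shift nu x e)) 0 1.

Lemma pd_lin a f g nu : pd_derivable f -> pd_derivable g ->
  pd (fun mu => a * f mu + g mu) nu = (fun x => a * pd f nu x + pd g nu x).
Proof.
move=> df dg; apply/funext => x; rewrite /pd.
have [_ dfx] := df nu x; have [_ dgx] := dg nu x.
have := deriveD (@derivableZ _ _ _ _ a _ _ dfx) dgx.
by rewrite deriveZ//; exact.
Qed.

Lemma pd_derivable_lin a f g : pd_derivable f -> pd_derivable g ->
  pd_derivable (fun mu => a * f mu + g mu).
Proof.
move=> df dg nu x; have [f0 dfx] := df nu x; have [g0 dgx] := dg nu x.
by split; [rewrite f0 g0|exact: (derivableD (@derivableZ _ _ _ _ a _ _ dfx) dgx)].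
Qed.

Lemma pd_derivable_mul f g : pd_derivable f -> pd_derivable g ->
  pd_derivable (fun mu => f mu * g mu).
Proof.
move=> df dg nu x; have [f0 dfx] := df nu x; have [g0 dgx] := dg nu x.
by split; [rewrite f0 g0|exact: (derivableM dfx dgx)].
Qed.

Lemma pd_mul f g nu : pd_derivable f -> pd_derivable g ->
  pd (fun mu => f mu * g mu) nu = (fun x => f nu * pd g nu x + g nu * pd f nu x).
Proof.
move=> df dg; apply/funext => x; rewrite /pd.
have [f0 dfx] := df nu x; have [g0 dgx] := dg nu x.
by have := deriveM dfx dgx; rewrite f0 g0; exact.
Qed.

(** The two-sided derivative of [u] equals its right derivative. This is how identities known only
    on M_+(E) are differentiated: adding mass stays in the cone, removing it may not. *)
Lemma derive_right (u v : R -> R) dv : derivable u 0 1 -> is_derive (0 : R) 1 v dv ->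
  (forall e, 0 <= e -> u e = v e) -> 'D_1 u 0 = dv.
Proof.
move=> du [dv' <-] uv; apply/eqP; rewrite -subr_eq0 -deriveB//; apply/eqP.
rewrite /derive cvg_at_rightE; last exact: derivableB.
apply: cvg_lim => //; apply: (@cvg_trans _ ((fun=> 0 : R) @ 0^'+)); last exact: cvg_cst.
apply: near_eq_cvg; near=> h.
have h0 : 0 <= h by apply: ltW; near: h; exact: nbhs_right_gt.
by rewrite /= addr0 [_%:A]mulr1 !fctE !uv// !subrr scaler0.
Unshelve. all: end_near. Qed.

End DirectionalDerivative.

Local Opaque mint.

Section Cylinder.
Context {R : realType} {T : ptopologicalType}.
Variable D : set (T -> R).
Hypothesis D_CDelta : D `<=` @CDelta R T.
Hypothesis D_one : D (fun=> 1).
Hypothesis D_lin : forall (a : R) f g, D f -> D g -> D (fun x => a * f x + g x).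
Implicit Types (f g h : T -> R) (nu mu : MM R T) (x y : T).

Lemma D_closed : lin_closed D.
Proof.
split=> //; have := D_lin (-1) _ _ D_one D_one.
by under eq_fun do rewrite mulr1 addNr.
Qed.

Lemma D_cst c : D (fun=> c).
Proof.
have := D_lin c _ _ D_one (proj1 D_closed).
by under eq_fun do rewrite mulr1 addr0.
Qed.

Lemma D_scale c g : D g -> D (fun x => c * g x).
Proof.
move=> Dg; have := D_lin c _ _ Dg (proj1 D_closed).
by under eq_fun do rewrite addr0.
Qed.

Lemma D_add g h : D g -> D h -> D (fun x => g x + h x).
Proof.
move=> Dg Dh; have := D_lin 1 _ _ Dg Dh.
by under eq_fun do rewrite mul1r.
Qed.

Definition tsym g h : T * T -> R := fun p => g p.1 * h p.2 + h p.1 * g p.2.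

Lemma DD_tsq g : D g -> DD D (tsq g).
Proof. by move=> Dg; apply: span_base; exists g. Qed.

(** Polarization, bracketed as iterated [a * f + g] so that the linearity lemmas apply term by
    term. *)
Lemma tsymE g h : tsym g h = fun p => 1 * tsq (fun x => g x + h x) p +
  ((-1) * tsq g p + ((-1) * tsq h p + 0)).
Proof. by apply/funext => p; rewrite /tsym /tsq; ring. Qed.

Lemma DD_tsym g h : D g -> D h -> DD D (tsym g h).
Proof.
move=> Dg Dh; rewrite tsymE.
apply: span_lin; first exact/DD_tsq/D_add.
apply: span_lin; first exact: DD_tsq.
by apply: span_lin; [exact: DD_tsq|exact: span0].
Qed.

Lemma DD_closed : lin_closed (DD D).
Proof. exact: span_lin_closed. Qed.

Lemma Dcal_closed : lin_closed (Dcal D).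
Proof. exact: span_lin_closed. Qed.

Definition mrow {m} (gs : 'I_m -> T -> R) nu : 'rV[R]_m := \row_(i < m) mint (gs i) nu.

Definition cyl {m} (gs : 'I_m -> T -> R) (phi : 'rV[R]_m -> R) : MM R T -> R :=
  fun nu => phi (mrow gs nu).

Lemma Dcal_cyl m (gs : 'I_m -> T -> R) phi : (forall i, D (gs i)) ->
  polyfun phi \/ C0inf phi -> Dcal D (cyl gs phi).
Proof. by move=> Dgs Hphi; apply: span_base; exists m, gs, phi. Qed.

Lemma Dbasic_ind (P : (MM R T -> R) -> Prop) :
  (forall m (gs : 'I_m -> T -> R) phi, (forall i, D (gs i)) ->
     polyfun phi \/ C0inf phi -> P (cyl gs phi)) ->
  forall f : MM R T -> R, Dbasic D f -> P f.
Proof. by move=> H f [m [gs [phi [Dgs [Hphi ->]]]]]; exact: H. Qed.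

Lemma adm_smooth m (phi : 'rV[R]_m -> R) : polyfun phi \/ C0inf phi -> smooth phi.
Proof. by case=> [/polyfun_smooth|[]]. Qed.

Lemma mrow_shift m (gs : 'I_m -> T -> R) nu x (e : R) : (forall i, D (gs i)) ->
  mrow gs (Defs.shift nu x e) = e *: (\row_i gs i x) + mrow gs nu.
Proof.
move=> Dgs; apply/rowP => i; rewrite !mxE mint_shift; last exact/D_CDelta/Dgs.
by rewrite addrC.
Qed.

Lemma is_derive_cyl m (gs : 'I_m -> T -> R) phi nu x : (forall i, D (gs i)) -> smooth phi ->
  is_derive (0 : R) 1 (fun e => cyl gs phi (Defs.shift nu x e))
    (\sum_i gs i x * pderiv i phi (mrow gs nu)).
Proof.
move=> Dgs sphi; rewrite /cyl; under eq_fun do rewrite mrow_shift//.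
apply/is_derive_lineP; apply: is_derive_eq; first exact: is_derive_smooth.
by apply: eq_bigr => i _; rewrite mxE.
Qed.

Lemma pd_cyl m (gs : 'I_m -> T -> R) phi nu x : (forall i, D (gs i)) -> smooth phi ->
  pd (cyl gs phi) nu x = \sum_i gs i x * pderiv i phi (mrow gs nu).
Proof. by move=> Dgs sphi; have [_] := is_derive_cyl m gs phi nu x Dgs sphi. Qed.

Lemma pd_cyl_cyl m (gs : 'I_m -> T -> R) phi y : (forall i, D (gs i)) -> smooth phi ->
  (fun nu => pd (cyl gs phi) nu y) = cyl gs (fun v => \sum_i gs i y * pderiv i phi v).
Proof. by move=> Dgs sphi; apply/funext => nu; rewrite pd_cyl. Qed.

Lemma pd2_cyl m (gs : 'I_m -> T -> R) phi nu : (forall i, D (gs i)) -> smooth phi ->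
  pd2 (cyl gs phi) nu = fun p => \sum_i \sum_j (gs i p.2 * gs j p.1) *
    pderiv j (pderiv i phi) (mrow gs nu).
Proof.
move=> Dgs sphi; apply/funext => -[x y]; rewrite /pd2 /= pd_cyl_cyl//.
have si i : smooth (fun v => gs i y * pderiv i phi v) by apply/smoothZ/smooth_pderiv.
rewrite (pd_cyl _ _ _ nu x Dgs (smooth_sum _ (index_enum 'I_m) _ si)).
rewrite exchange_big /=; apply: eq_bigr => j _; rewrite pderiv_sum// mulr_sumr.
apply: eq_bigr => i _; rewrite /pderiv deriveZ; last exact/smooth_derivable/smooth_pderiv.
by rewrite /GRing.scale /=; ring.
Qed.

(** The derivability clauses make [pd] and [pd2] linear; the membership clauses put their values
    into the domains of the operators of a representation. *)
Definition regular (f : MM R T -> R) := [/\ pd_derivable f,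
  forall y, pd_derivable (fun nu => pd f nu y),
  forall nu, D (pd f nu) & forall nu, DD D (pd2 f nu)].

Lemma pd_lin_fun (a : R) (f g : MM R T -> R) y : pd_derivable f -> pd_derivable g ->
  (fun nu => pd (fun mu => a * f mu + g mu) nu y) = fun nu => a * pd f nu y + pd g nu y.
Proof. by move=> df dg; apply/funext => nu; rewrite (pd_lin a _ _ nu df dg). Qed.

Lemma pd2_lin (a : R) (f g : MM R T -> R) nu : regular f -> regular g ->
  pd2 (fun mu => a * f mu + g mu) nu = fun p => a * pd2 f nu p + pd2 g nu p.
Proof.
move=> [df df2 _ _] [dg dg2 _ _]; apply/funext => p; rewrite /pd2 (pd_lin_fun _ _ _ _ df dg).
exact: (congr1 (@^~ p.1) (pd_lin a _ _ nu (df2 p.2) (dg2 p.2))).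
Qed.

Lemma regular_lin (a : R) (f g : MM R T -> R) : regular f -> regular g ->
  regular (fun mu => a * f mu + g mu).
Proof.
move=> rf rg; have [df df2 Df DDf] := rf; have [dg dg2 Dg DDg] := rg; split.
- exact: pd_derivable_lin.
- by move=> y; rewrite (pd_lin_fun _ _ _ _ df dg); exact: (pd_derivable_lin a _ _ (df2 y) (dg2 y)).
- by move=> nu; rewrite (pd_lin a _ _ nu df dg); exact: D_lin.
- by move=> nu; rewrite (pd2_lin _ _ _ _ rf rg); exact: (span_lin _ a _ _ (DDf nu) (DDg nu)).
Qed.

Lemma cyl0 : (fun=> 0) = cyl (fun (_ : 'I_0) (_ : T) => 0) (fun=> 0) :> (MM R T -> R).
Proof. by []. Qed.

(** Writing the Hessian as [b i j + b j i] groups the second derivative into symmetric products,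
    which is what places it in [DD D]. The factor 1 gives the outer sum the shape [c k * F k]. *)
Lemma pd2_cyl_tsym m (gs : 'I_m -> T -> R) phi nu (b : 'I_m -> 'I_m -> R) :
  (forall i, D (gs i)) -> smooth phi ->
  (forall i j, pderiv j (pderiv i phi) (mrow gs nu) = b i j + b j i) ->
  pd2 (cyl gs phi) nu = fun p => \sum_i 1 * \sum_j b i j * tsym (gs i) (gs j) p.
Proof.
move=> Dgs sphi bE; rewrite pd2_cyl//; apply/funext => p; rewrite /tsym.
transitivity (\sum_i \sum_j (gs i p.2 * gs j p.1 * b i j) + \sum_i \sum_j (gs i p.2 * gs j p.1 * b j i)).
  rewrite -big_split /=; apply: eq_bigr => i _; rewrite -big_split /=; apply: eq_bigr => j _.
  by rewrite bE mulrDr.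
rewrite [X in _ + X]exchange_big /= -big_split /=; apply: eq_bigr => i _.
rewrite mul1r -big_split /=; apply: eq_bigr => j _; ring.
Qed.

Lemma regular_cyl m (gs : 'I_m -> T -> R) phi : (forall i, D (gs i)) -> smooth phi ->
  regular (cyl gs phi).
Proof.
move=> Dgs sphi; split.
- move=> nu x; split; first by rewrite /cyl (mrow_shift m gs nu x 0 Dgs) scale0r add0r.
  by have [] := is_derive_cyl m gs phi nu x Dgs sphi.
- move=> y; rewrite pd_cyl_cyl// => nu x.
  have sy : smooth (fun v => \sum_i gs i y * pderiv i phi v).
    by apply: smooth_sum => i; apply/smoothZ/smooth_pderiv.
  split; first by rewrite /cyl (mrow_shift m gs nu x 0 Dgs) scale0r add0r.
  by have [] := is_derive_cyl m gs _ nu x Dgs sy.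
- move=> nu; rewrite (funext (fun x => pd_cyl m gs phi nu x Dgs sphi)).
  under eq_fun do under eq_bigr do rewrite mulrC.
  exact: (lin_closed_sum D _ _ _ _ D_closed Dgs).
(* Only the coefficients of the Taylor expansion are used here, as a splitting of the Hessian. *)
- move=> nu; have [b [psi [_ bE _]]] := taylor3 phi (mrow gs nu) sphi.
  rewrite (pd2_cyl_tsym m gs phi nu b)//.
  apply: (lin_closed_sum (DD D) _ _ (fun=> 1)) => [|i]; first exact: DD_closed.
  apply: (lin_closed_sum (DD D)) => [|j]; first exact: DD_closed.
  exact: DD_tsym.
Qed.

Lemma Dcal_regular (f : MM R T -> R) : Dcal D f -> regular f.
Proof.
apply: span_ind; first by rewrite cyl0; apply: regular_cyl => [[]//|]; exact: smooth_cst.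
move=> a {}f g Bf _ rg; apply: (regular_lin _ _ _ _ rg).
by apply: (Dbasic_ind _ _ f Bf) => m gs phi Dgs /adm_smooth sphi; exact: regular_cyl.
Qed.

Definition expf g : MM R T -> R := cyl (fun _ : 'I_1 => g) cutoff_exp.

Lemma Dcal_expf g : D g -> Dcal D (expf g).
Proof. by move=> Dg; apply: Dcal_cyl => //; right; exact: cutoff_exp_C0inf. Qed.

(** The sign condition in [Dminus] enters here: it keeps [mint g nu] where the cut-off leaves the
    exponential unchanged. *)
Lemma expfE g nu : Dminus D g -> Mplus nu -> expf g nu = expR (mint g nu).
Proof.
move=> [Dg g0] nu0; rewrite /expf /cyl cutoff_expE !mxE//.
by apply: mint_le0 => //; exact: D_CDelta.
Qed.

Lemma is_derive_exp_shift g nu x c : D g ->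
  is_derive (0 : R) 1 (fun e => expR (mint g (Defs.shift nu x e)) * c)
    (expR (mint g nu) * g x * c).
Proof.
move=> Dg; under eq_fun do rewrite (mint_shift _ _ _ _ (D_CDelta _ Dg)).
have := @is_derive1_comp _ expR _ _ _ _ (is_derive_expR _) (is_derive_affine (mint g nu) (g x) 0).
rewrite mul0r addr0 => De.
have := @is_deriveZ R R R _ c _ _ _ De.
rewrite /GRing.scale /= mulrC => H.
by rewrite (_ : (fun e => _) = (fun e => c * expR (mint g nu + e * g x)))//; apply/funext => e; rewrite mulrC.
Qed.

Lemma exp_pd (f : MM R T -> R) g : Dcal D f -> D g ->
  (forall nu, Mplus nu -> f nu = expR (mint g nu)) ->
  forall nu, Mplus nu -> pd f nu = (fun x => expR (mint g nu) * g x) /\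
    pd2 f nu = (fun p => expR (mint g nu) * tsq g p).
Proof.
move=> /Dcal_regular [df df2 _ _] Dg fE.
have pdf nu : Mplus nu -> pd f nu = (fun x => expR (mint g nu) * g x).
  move=> nu0; apply/funext => x.
  have De := is_derive_exp_shift g nu x 1 Dg; rewrite mulr1 in De.
  apply: (derive_right _ _ _ (proj2 (df nu x)) De) => e e0.
  by rewrite mulr1 fE//; exact: Mplus_shift.
move=> nu nu0; split; first exact: pdf.
apply/funext => -[x y]; rewrite /pd2 /= /tsq /= mulrA.
apply: (derive_right _ _ _ (proj2 (df2 y nu x)) (is_derive_exp_shift g nu x (g y) Dg)) => e e0.
by rewrite pdf//; exact: Mplus_shift.
Qed.

(** * Pairing elements of [DD D] with squares of signed measures *)

Lemma mintZ c g nu : CDelta g -> mint (fun x => c * g x) nu = c * mint g nu.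
Proof.
move=> Cg; have := mint_lin c g _ nu Cg (CDelta_cst 0).
by under [X in mint X]eq_fun do rewrite addr0; rewrite mint_cst0 addr0.
Qed.

Lemma CDeltaZ (c : R) g : CDelta g -> CDelta (fun x => c * g x).
Proof.
move=> Cg; have := CDelta_lin c g _ Cg (CDelta_cst 0).
by under eq_fun do rewrite addr0.
Qed.

(** Keeps both integrations of an iterated integral within [CDelta], where [mint] is known to be
    linear. *)
Definition slice_ok (h : T * T -> R) := (forall x, CDelta (fun y => h (x, y))) /\
  forall mu, CDelta (fun x => mint (fun y => h (x, y)) mu).

Lemma slice_ok_lin (a : R) (h k : T * T -> R) : slice_ok h -> slice_ok k ->
  slice_ok (fun p => a * h p + k p).
Proof.
move=> [h1 h2] [k1 k2]; split=> [x|mu]; first exact: (CDelta_lin a _ _ (h1 x) (k1 x)).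
under eq_fun => x do rewrite (mint_lin _ _ _ _ (h1 x) (k1 x)).
exact: (CDelta_lin a _ _ (h2 mu) (k2 mu)).
Qed.

Lemma slice_ok_tsq g : CDelta g -> slice_ok (tsq g).
Proof.
move=> Cg; split=> [x|mu]; rewrite /tsq /=; first exact: CDeltaZ.
under eq_fun => x do rewrite mintZ//.
by under eq_fun => x do rewrite mulrC; exact: CDeltaZ.
Qed.

Lemma slice_ok0 : slice_ok (fun=> 0).
Proof.
split=> [x|mu]; first exact: CDelta_cst.
by rewrite mint_cst0; exact: CDelta_cst.
Qed.

Lemma DD_slice_ok (h : T * T -> R) : DD D h -> slice_ok h.
Proof.
apply: span_ind; first exact: slice_ok0.
by move=> a _ k [g Dg <-] _ sk; apply: slice_ok_lin => //; exact/slice_ok_tsq/D_CDelta.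
Qed.

(** The inner integral against [mu - nu]. It is defined from [h] itself, so linearity in [h] does
    not depend on an expression of [h] as a span. *)
Definition quad_slice (h : T * T -> R) mu nu : T -> R :=
  fun x => - 1 * mint (fun y => h (x, y)) nu + mint (fun y => h (x, y)) mu.

(* [quad h mu nu] is the pairing of [h] with [(mu - nu)^{\otimes 2}]. *)
Definition quad (h : T * T -> R) mu nu : R :=
  mint (quad_slice h mu nu) mu - mint (quad_slice h mu nu) nu.

Lemma CDelta_quad_slice (h : T * T -> R) mu nu : slice_ok h -> CDelta (quad_slice h mu nu).
Proof. by move=> [h1 h2]; exact: (CDelta_lin (-1) _ _ (h2 nu) (h2 mu)). Qed.

Lemma quad_slice_lin (a : R) (h k : T * T -> R) mu nu : slice_ok h -> slice_ok k ->
  quad_slice (fun p => a * h p + k p) mu nu =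
  fun x => a * quad_slice h mu nu x + quad_slice k mu nu x.
Proof.
move=> [h1 h2] [k1 k2]; apply/funext => x; rewrite /quad_slice.
by rewrite (mint_lin a _ _ mu (h1 x) (k1 x)) (mint_lin a _ _ nu (h1 x) (k1 x)); ring.
Qed.

Lemma mint_diff_lin (a : R) f g mu nu : CDelta f -> CDelta g ->
  mint (fun x => a * f x + g x) mu - mint (fun x => a * f x + g x) nu =
  a * (mint f mu - mint f nu) + (mint g mu - mint g nu).
Proof. by move=> Cf Cg; rewrite (mint_lin a _ _ mu Cf Cg) (mint_lin a _ _ nu Cf Cg); ring. Qed.

Lemma quad_lin (a : R) (h k : T * T -> R) mu nu : slice_ok h -> slice_ok k ->
  quad (fun p => a * h p + k p) mu nu = a * quad h mu nu + quad k mu nu.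
Proof.
move=> sh sk; rewrite /quad (quad_slice_lin _ _ _ _ _ sh sk).
exact: (mint_diff_lin a _ _ mu nu (CDelta_quad_slice _ mu nu sh) (CDelta_quad_slice _ mu nu sk)).
Qed.

Lemma quad0 mu nu : quad (fun=> 0) mu nu = 0.
Proof.
rewrite /quad (_ : quad_slice _ _ _ = fun=> 0); first by rewrite !mint_cst0 subrr.
by apply/funext => x; rewrite /quad_slice !mint_cst0; ring.
Qed.

Lemma quad_tsq g mu nu : CDelta g -> quad (tsq g) mu nu = (mint g mu - mint g nu) ^+ 2.
Proof.
move=> Cg.
have E : quad_slice (tsq g) mu nu = fun x => (mint g mu - mint g nu) * g x.
  apply/funext => x; rewrite /quad_slice /tsq /= (mintZ _ _ mu Cg) (mintZ _ _ nu Cg).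
  by ring.
by rewrite /quad E (mintZ _ _ mu Cg) (mintZ _ _ nu Cg) -mulrBr expr2.
Qed.

(** Polarization of [quad_tsq]; the factor 2 reflects that [tsym g g] is twice [tsq g]. *)
Lemma quad_tsym g h mu nu : D g -> D h ->
  quad (tsym g h) mu nu = 2 * ((mint g mu - mint g nu) * (mint h mu - mint h nu)).
Proof.
move=> Dg Dh; have Cg := D_CDelta _ Dg; have Ch := D_CDelta _ Dh.
have Cgh := D_CDelta _ (D_add _ _ Dg Dh).
have S0 := slice_ok0; have Sg := slice_ok_tsq _ Cg; have Sh := slice_ok_tsq _ Ch.
have Sgh := slice_ok_tsq _ Cgh.
have S1 : slice_ok (fun p => -1 * tsq h p + 0) := slice_ok_lin (-1) (tsq h) (fun=> 0) Sh S0.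
have S2 : slice_ok (fun p => -1 * tsq g p + (-1 * tsq h p + 0)) :=
  slice_ok_lin (-1) (tsq g) (fun p => -1 * tsq h p + 0) Sg S1.
rewrite tsymE (quad_lin _ _ _ mu nu Sgh S2) (quad_lin _ _ _ mu nu Sg S1).
rewrite (quad_lin _ _ _ mu nu Sh S0) quad0.
rewrite (quad_tsq _ mu nu Cg) (quad_tsq _ mu nu Ch) (quad_tsq _ mu nu Cgh).
have mgh rho : mint (fun x => g x + h x) rho = mint g rho + mint h rho.
  have := mint_lin 1 _ _ rho Cg Ch.
  by under [X in mint X]eq_fun do rewrite mul1r; rewrite mul1r.
by rewrite !mgh; ring.
Qed.

Lemma polyfun_coordB m (i : 'I_m) (c : R) : polyfun (fun v : 'rV[R]_m => v ord0 i - c).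
Proof. by apply: pf_add; [exact: pf_coord|exact: pf_const]. Qed.

Lemma polyfun_sum m (I : Type) (r : seq I) (F : I -> 'rV[R]_m -> R) :
  (forall k, polyfun (F k)) -> polyfun (fun v => \sum_(k <- r) F k v).
Proof.
move=> pF; elim: r => [|k r IH].
  by under eq_fun do rewrite big_nil; exact: pf_const.
by under eq_fun do rewrite big_cons; exact: pf_add.
Qed.

Lemma Dcal_cst (c : R) : Dcal D (fun=> c).
Proof.
rewrite (_ : (fun=> c) = cyl (fun (_ : 'I_0) (_ : T) => 0) (fun=> c))//.
by apply: Dcal_cyl => [[]//|]; left; exact: pf_const.
Qed.

Lemma Dcal_mint g : D g -> Dcal D (mint g).
Proof.
move=> Dg; rewrite (_ : mint g = cyl (fun _ : 'I_1 => g) (fun v => v ord0 ord0)).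
  by apply: Dcal_cyl => //; left; exact: pf_coord.
by apply/funext => mu; rewrite /cyl mxE.
Qed.

Lemma Dcal_quad (h : T * T -> R) nu : DD D h -> Dcal D (fun mu => quad h mu nu).
Proof.
suff H : DD D h -> DD D h /\ Dcal D (fun mu => quad h mu nu) by move=> /H [].
apply: (span_ind _ (fun h : T * T -> R => DD D h /\ Dcal D (fun mu => quad h mu nu))).
  split; first exact: span0.
  by rewrite (funext (fun mu => quad0 mu nu)); exact: Dcal_cst.
move=> a _ k [g Dg <-] _ [Dk Qk].
have Cg := D_CDelta _ Dg; have Dg2 := DD_tsq _ Dg; split; first exact: span_lin.
have Sg := slice_ok_tsq _ Cg; have Sk := DD_slice_ok _ Dk.
under eq_fun => mu do rewrite (quad_lin a _ _ mu nu Sg Sk) (quad_tsq _ mu nu Cg).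
apply: (proj2 Dcal_closed a _ _ _ Qk).
rewrite (_ : (fun mu => _) = cyl (fun _ : 'I_1 => g)
  (fun v => (v ord0 ord0 - mint g nu) * (v ord0 ord0 - mint g nu))).
  by apply: Dcal_cyl => //; left; apply: pf_mul; exact: polyfun_coordB.
by apply/funext => mu; rewrite /cyl mxE expr2.
Qed.

(** * Reduction of the operator to 2-jets *)

Section Operator.
Variable L : (MM R T -> R) -> (MM R T -> R).
Hypothesis L_linear : linear_L D L.

Lemma L_lin (a : R) (f g : MM R T -> R) nu : Dcal D f -> Dcal D g ->
  L (fun mu => a * f mu + g mu) nu = a * L f nu + L g nu.
Proof. by move=> Df Dg; rewrite L_linear. Qed.

Lemma L_sum (I : Type) (r : seq I) (c : I -> R) (F : I -> MM R T -> R) nu :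
  (forall k, Dcal D (F k)) ->
  L (fun mu => \sum_(k <- r) c k * F k mu) nu = \sum_(k <- r) c k * L (F k) nu.
Proof.
by move=> DF; rewrite (lin_on_fun_sum _ _ L _ r c F Dcal_closed L_linear DF).
Qed.

Lemma Dcal_sum (I : Type) (r : seq I) (c : I -> R) (F : I -> MM R T -> R) :
  (forall k, Dcal D (F k)) -> Dcal D (fun mu => \sum_(k <- r) c k * F k mu).
Proof. exact: (lin_closed_sum _ _ _ _ _ Dcal_closed). Qed.

Definition Bop g nu : R := L (mint g) nu.
Definition Qop (h : T * T -> R) nu : R := L (fun mu => quad h mu nu) nu.

Lemma Bop_lin : lin_on_fun D Bop.
Proof.
move=> a f g Df Dg; apply/funext => nu; rewrite /Bop -L_lin; [|exact: Dcal_mint..].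
congr (L _ nu); apply/funext => mu.
by rewrite mint_lin//; exact: D_CDelta.
Qed.

Lemma Qop_lin : lin_on_fun (DD D) Qop.
Proof.
move=> a h k Dh Dk; apply/funext => nu; rewrite /Qop -L_lin; [|exact: Dcal_quad..].
congr (L _ nu); apply/funext => mu.
by rewrite quad_lin//; exact: DD_slice_ok.
Qed.

Section Derivation.
Hypothesis L_der : derivation D L.

(** For [p = q = r = 1] every [Gamma] equals [- L 1], and the derivation identity reads
    [- L 1 = - 2 L 1]. *)
Lemma L_cst (c : R) nu : Mplus nu -> L (fun=> c) nu = 0.
Proof.
move=> nu0.
have D1 := Dcal_cst 1.
have E1 : (fun _ : MM R T => 1 * 1 : R) = (fun=> 1) by rewrite mulr1.
have E2 : (fun _ : MM R T => 1 * 1 * 1 : R) = (fun=> 1) by rewrite !mulr1.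
have := L_der _ _ _ D1 D1 D1.
rewrite E1 E2 => /(_ D1 D1 D1 D1 nu nu0).
rewrite /Gamma E1 => H.
have {}H : L (fun=> 1) nu = 0 by move: H; rewrite !mul1r; lra.
have := L_linear c _ _ D1 (proj1 Dcal_closed).
rewrite (lin_on_fun0 _ _ _ Dcal_closed L_linear) => /(congr1 (@^~ nu)).
by under [X in L X]eq_fun do rewrite mulr1 addr0; rewrite H mulr0 addr0.
Qed.

(** In the derivation identity at [nu], every term other than [L (p q r)] has one of [p], [q], [r]
    as an outside factor. *)
Lemma L_triple (p q r : MM R T -> R) nu : Mplus nu ->
  Dcal D p -> Dcal D q -> Dcal D r ->
  Dcal D (fun mu => p mu * q mu) -> Dcal D (fun mu => q mu * r mu) ->
  Dcal D (fun mu => p mu * r mu) -> Dcal D (fun mu => p mu * q mu * r mu) ->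
  p nu = 0 -> q nu = 0 -> r nu = 0 -> L (fun mu => p mu * q mu * r mu) nu = 0.
Proof.
move=> nu0 Dp Dq Dr Dpq Dqr Dpr Dpqr p0 q0 r0.
have := L_der _ _ _ Dp Dq Dr Dpq Dqr Dpr Dpqr nu nu0.
by rewrite /Gamma p0 q0 r0 !mul0r !subr0 addr0.
Qed.

Section FixedCylinder.
Context {m : nat} (gs : 'I_m -> T -> R) (nu : MM R T).
Hypothesis Dgs : forall i, D (gs i).
Hypothesis nu_ge0 : Mplus nu.
Implicit Types (phi rho sigma : 'rV[R]_m -> R).
Let a : 'rV[R]_m := mrow gs nu.

Let Dcal_poly phi : polyfun phi -> Dcal D (cyl gs phi).
Proof. by move=> pp; apply: Dcal_cyl => //; left. Qed.

Let Dcal_csupp phi : csupp phi -> Dcal D (cyl gs phi).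
Proof. by move=> pp; apply: Dcal_cyl => //; right; exact: csupp_C0inf. Qed.

(** Multiplying by 1 plus a compactly supported function only adds a compactly supported term, so it
    preserves the domain even where general products do not. *)
Lemma Dcal_cyl_mulD rho sigma : smooth rho -> Dcal D (cyl gs rho) -> csupp sigma ->
  Dcal D (cyl gs (fun v => (1 + sigma v) * rho v)).
Proof.
move=> sr Dr cs.
have Ds := Dcal_csupp _ (csuppM _ _ sr cs).
have := proj2 Dcal_closed 1 _ _ Ds Dr.
rewrite (_ : (fun mu => _) = cyl gs (fun v => (1 + sigma v) * rho v))//.
by apply/funext => mu; rewrite /cyl; ring.
Qed.

Lemma L_far chi rho : csupp chi -> chi a = 1 -> smooth rho -> Dcal D (cyl gs rho) ->
  L (cyl gs (fun v => (1 - chi v) * (1 - chi v) * ((1 - chi v) * rho v))) nu = 0.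
Proof.
move=> cc chia sr Dr.
have sc : smooth chi by case: cc.
have sk (c : R) : smooth (fun _ : 'rV[R]_m => c) by exact: smooth_cst.
have s1 := smoothB _ _ (sk 1) sc.
have D1 : Dcal D (cyl gs (fun=> 1)) by apply: Dcal_poly; exact: pf_const.
(* The functions in [c1], [c2], [c3] are [(1 - chi) ^ k - 1] for [k = 1, 2, 3], with a factor [chi]
   pulled out to exhibit their compact support. *)
have c1 : csupp (fun v => -1 * chi v) := csuppM (fun=> -1) chi (sk (-1)) cc.
have c2 : csupp (fun v => (chi v - 2) * chi v) :=
  csuppM (fun v => chi v - 2) chi (smoothB _ _ sc (sk 2)) cc.
have c3 : csupp (fun v => (3 * chi v - chi v * chi v - 3) * chi v) :=
  csuppM (fun v => 3 * chi v - chi v * chi v - 3) chi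
    (smoothB _ _ (smoothB _ _ (smoothZ 3 _ sc) (smoothM _ _ sc sc)) (sk 3)) cc.
have Dp : Dcal D (cyl gs (fun v => 1 - chi v)).
  have := Dcal_cyl_mulD _ _ (sk 1) D1 c1.
  by under [X in cyl gs X]eq_fun do rewrite mulr1 mulN1r.
have Dpq : Dcal D (cyl gs (fun v => (1 - chi v) * (1 - chi v))).
  have := Dcal_cyl_mulD _ _ (sk 1) D1 c2.
  by rewrite (_ : (fun v => _ * 1) = fun v => (1 - chi v) * (1 - chi v))//; apply/funext => v; ring.
have D1r : Dcal D (cyl gs (fun v => (1 - chi v) * rho v)).
  have := Dcal_cyl_mulD _ _ sr Dr c1.
  by under [X in cyl gs X]eq_fun do rewrite mulN1r.
have D2r : Dcal D (cyl gs (fun v => (1 - chi v) * ((1 - chi v) * rho v))).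
  have := Dcal_cyl_mulD _ _ sr Dr c2.
  by rewrite (_ : (fun v => (1 + _) * _) = fun v => (1 - chi v) * ((1 - chi v) * rho v))//; apply/funext => v; ring.
have D3r : Dcal D (cyl gs (fun v => (1 - chi v) * (1 - chi v) * ((1 - chi v) * rho v))).
  have := Dcal_cyl_mulD _ _ sr Dr c3.
  by rewrite (_ : (fun v => (1 + _) * _) = fun v => (1 - chi v) * (1 - chi v) * ((1 - chi v) * rho v))//; apply/funext => v; ring.
have z : 1 - chi a = 0 by rewrite chia subrr.
apply: (L_triple (cyl gs (fun v => 1 - chi v)) (cyl gs (fun v => 1 - chi v))
  (cyl gs (fun v => (1 - chi v) * rho v)) nu nu_ge0 Dp Dp D1r Dpq D2r D2r D3r z z).
by rewrite /cyl -/a z mul0r.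
Qed.

(** The bump is attached to the third factor; all the products required are then either polynomial
    or compactly supported. *)
Lemma L_near i j k psi chi : smooth psi -> csupp chi ->
  L (cyl gs (fun v => (v ord0 i - a ord0 i) * (v ord0 j - a ord0 j) *
    ((v ord0 k - a ord0 k) * psi v * chi v))) nu = 0.
Proof.
move=> sp cc.
have sB (l : 'I_m) : smooth (fun v : 'rV[R]_m => v ord0 l - a ord0 l) by exact: smooth_coordB.
have pB (l : 'I_m) : polyfun (fun v : 'rV[R]_m => v ord0 l - a ord0 l) by exact: polyfun_coordB.
have cr : csupp (fun v => (v ord0 k - a ord0 k) * psi v * chi v) :=
  csuppM (fun v => (v ord0 k - a ord0 k) * psi v) chi (smoothM _ _ (sB k) sp) cc.
apply: (L_triple (cyl gs (fun v => v ord0 i - a ord0 i)) (cyl gs (fun v => v ord0 j - a ord0 j))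
  (cyl gs (fun v => (v ord0 k - a ord0 k) * psi v * chi v)) nu nu_ge0).
- exact: Dcal_poly.
- exact: Dcal_poly.
- exact: Dcal_csupp.
- exact: (Dcal_poly (fun v => (v ord0 i - a ord0 i) * (v ord0 j - a ord0 j)) (pf_mul (pB i) (pB j))).
- exact: (Dcal_csupp (fun v => (v ord0 j - a ord0 j) * ((v ord0 k - a ord0 k) * psi v * chi v)) (csuppM _ _ (sB j) cr)).
- exact: (Dcal_csupp (fun v => (v ord0 i - a ord0 i) * ((v ord0 k - a ord0 k) * psi v * chi v)) (csuppM _ _ (sB i) cr)).
- exact: (Dcal_csupp (fun v => (v ord0 i - a ord0 i) * (v ord0 j - a ord0 j) * ((v ord0 k - a ord0 k) * psi v * chi v)) (csuppM _ _ (smoothM _ _ (sB i) (sB j)) cr)).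
- exact: subrr.
- exact: subrr.
- by rewrite /cyl -/a subrr !mul0r.
Qed.

(* A third-order remainder [rho] is split by a bump function [chi] with
   [chi a = 1] as [(1 - chi)^3 rho + (1 - (1 - chi)^3) rho]: both parts are
   sums of triple products of elements of [Dcal] vanishing at [nu]. *)
Lemma L_remainder rho (psi : 'I_m -> 'I_m -> 'I_m -> 'rV[R]_m -> R) :
  smooth rho -> Dcal D (cyl gs rho) -> (forall i j k, smooth (psi i j k)) ->
  (forall v, rho v = \sum_i \sum_j \sum_k (v ord0 i - a ord0 i) * (v ord0 j - a ord0 j) *
    ((v ord0 k - a ord0 k) * psi i j k v)) ->
  L (cyl gs rho) nu = 0.
Proof.
move=> sr Dr spsi E; have [chi [cc chia]] := exists_bump a.
have sc : smooth chi by case: cc.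
have sk (c : R) : smooth (fun _ : 'rV[R]_m => c) by exact: smooth_cst.
(* This is [1 - (1 - chi) ^ 3], with a factor [chi] pulled out. *)
pose chi' v : R := (3 - 3 * chi v + chi v * chi v) * chi v.
have cc' : csupp chi' := csuppM (fun v => 3 - 3 * chi v + chi v * chi v) chi
  (smoothD _ _ (smoothB _ _ (sk 3) (smoothZ 3 _ sc)) (smoothM _ _ sc sc)) cc.
pose F i j k := cyl gs (fun v => (v ord0 i - a ord0 i) * (v ord0 j - a ord0 j) *
    ((v ord0 k - a ord0 k) * psi i j k v * chi' v)).
have sB (l : 'I_m) : smooth (fun v : 'rV[R]_m => v ord0 l - a ord0 l) by exact: smooth_coordB.
have DF i j k : Dcal D (F i j k).
  exact: (Dcal_csupp _ (csuppM (fun v => (v ord0 i - a ord0 i) * (v ord0 j - a ord0 j))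
    (fun v => (v ord0 k - a ord0 k) * psi i j k v * chi' v) (smoothM _ _ (sB i) (sB j))
    (csuppM (fun v => (v ord0 k - a ord0 k) * psi i j k v) chi' (smoothM _ _ (sB k) (spsi i j k)) cc'))).
pose G := cyl gs (fun v => (1 - chi v) * (1 - chi v) * ((1 - chi v) * rho v)).
pose H mu := \sum_i 1 * \sum_j 1 * \sum_k 1 * F i j k mu.
have DH2 i : Dcal D (fun mu => \sum_j 1 * \sum_k 1 * F i j k mu).
  by apply: Dcal_sum => j; exact: Dcal_sum.
have DH : Dcal D H by exact: Dcal_sum.
have HE mu : H mu = chi' (mrow gs mu) * rho (mrow gs mu).
  rewrite /H E mulr_sumr; apply: eq_bigr => i _; rewrite mul1r mulr_sumr.
  apply: eq_bigr => j _; rewrite mul1r mulr_sumr; apply: eq_bigr => k _.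
  by rewrite mul1r /F /cyl; ring.
have E2 : cyl gs rho = fun mu => 1 * G mu + H mu.
  by apply/funext => mu; rewrite HE /G /cyl /chi'; ring.
have DG : Dcal D G.
  have := proj2 Dcal_closed (-1) _ _ DH Dr.
  rewrite (_ : (fun mu => _) = G)//.
  by apply/funext => mu; rewrite HE /G /cyl /chi'; ring.
rewrite E2 L_lin// /G L_far// mulr0 add0r /H L_sum//.
apply: big1 => i _; rewrite mul1r L_sum; last by move=> j; exact: Dcal_sum.
apply: big1 => j _; rewrite mul1r L_sum//.
by apply: big1 => k _; rewrite mul1r (L_near i j k (psi i j k) chi' (spsi i j k) cc').
Qed.

Lemma L_cyl phi : polyfun phi \/ C0inf phi ->
  L (cyl gs phi) nu = Bop (pd (cyl gs phi) nu) nu + 2^-1 * Qop (pd2 (cyl gs phi) nu) nu.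
Proof.
move=> adm; have sphi := adm_smooth _ _ adm.
have [b [psi [spsi bE E]]] := taylor3 phi a sphi.
pose d (i : 'I_m) := cyl gs (fun v => v ord0 i - a ord0 i).
pose al i := pderiv i phi a.
(* The Taylor polynomial lies in the domain whichever kind [phi] is, hence so does [phi - P2], by
   linearity alone. *)
pose P2 (v : 'rV[R]_m) := phi a + \sum_i (v ord0 i - a ord0 i) * al i
  + \sum_i \sum_j (v ord0 i - a ord0 i) * (v ord0 j - a ord0 j) * b i j.
have pP2 : polyfun P2.
  apply: pf_add; first apply: pf_add; first exact: pf_const.
    by apply: polyfun_sum => i; apply: pf_mul; [exact: polyfun_coordB|exact: pf_const].
  apply: polyfun_sum => i; apply: polyfun_sum => j.
  by apply: pf_mul; [apply: pf_mul; exact: polyfun_coordB|exact: pf_const].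
have Dphi := Dcal_cyl m gs phi Dgs adm.
have DP2 := Dcal_poly _ pP2.
pose rho v := phi v - P2 v.
have srho : smooth rho := smoothB _ _ sphi (polyfun_smooth _ pP2).
have Drho : Dcal D (cyl gs rho).
  have := proj2 Dcal_closed (-1) _ _ DP2 Dphi.
  rewrite (_ : (fun mu => _) = cyl gs rho)//.
  by apply/funext => mu; rewrite /cyl /rho mulN1r addrC.
have L0 : L (cyl gs rho) nu = 0.
  apply: (L_remainder _ psi) => // v.
  by rewrite /rho E addrAC subrr add0r.
have -> : L (cyl gs phi) nu = L (cyl gs P2) nu.
  have -> : cyl gs phi = fun mu => 1 * cyl gs rho mu + cyl gs P2 mu.
    by apply/funext => mu; rewrite /cyl /rho mul1r subrK.
  by rewrite L_lin// L0 mulr0 add0r.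
have dE i mu : d i mu = mint (gs i) mu - mint (gs i) nu by rewrite /d /cyl /a !mxE.
have Dd i : Dcal D (d i) by apply: Dcal_poly; exact: polyfun_coordB.
have Ddd i j : Dcal D (fun mu => d i mu * d j mu).
  exact: (Dcal_poly (fun v => (v ord0 i - a ord0 i) * (v ord0 j - a ord0 j))
    (pf_mul (polyfun_coordB _ i _) (polyfun_coordB _ j _))).
have Ld i : L (d i) nu = Bop (gs i) nu.
  have -> : d i = fun mu => 1 * mint (gs i) mu + - mint (gs i) nu.
    by apply/funext => mu; rewrite dE mul1r.
  rewrite (L_lin 1 (mint (gs i)) (fun=> _) nu); [|exact: Dcal_mint|exact: Dcal_cst].
  by rewrite L_cst// addr0 mul1r.
(* The factor [2^-1] undoes the 2 of [quad_tsym]; it becomes the one half of the representation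
   formula. *)
have Ldd i j : L (fun mu => d i mu * d j mu) nu = 2^-1 * Qop (tsym (gs i) (gs j)) nu.
  rewrite /Qop (_ : (fun mu => quad _ mu nu) = fun mu => 2 * (d i mu * d j mu)).
    rewrite (lin_on_funZ _ _ L 2 _ Dcal_closed L_linear (Ddd i j)).
    by rewrite mulrA mulVf ?mul1r// pnatr_eq0.
  by apply/funext => mu; rewrite quad_tsym// !dE.
have Dsum1 : Dcal D (fun mu => \sum_i al i * d i mu) by exact: Dcal_sum.
have Dsum2 i : Dcal D (fun mu => \sum_j b i j * (d i mu * d j mu)).
  exact: (Dcal_sum _ _ (b i) (fun j mu => d i mu * d j mu) (Ddd i)).
have Dsum : Dcal D (fun mu => \sum_i 1 * \sum_j b i j * (d i mu * d j mu)).
  exact: (Dcal_sum _ _ (fun=> 1) _ Dsum2).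
have -> : cyl gs P2 = fun mu => 1 * (1 * (\sum_i al i * d i mu) + phi a) +
    \sum_i 1 * \sum_j b i j * (d i mu * d j mu).
  apply/funext => mu; rewrite /cyl /P2 !mul1r; congr (_ + _).
    by rewrite addrC; congr (_ + _); apply: eq_bigr => i _; rewrite mulrC.
  by apply: eq_bigr => i _; rewrite mul1r; apply: eq_bigr => j _; rewrite mulrC.
have Dc := Dcal_cst (phi a).
rewrite L_lin//; last exact: (proj2 Dcal_closed 1 _ _ Dsum1 Dc).
rewrite (L_lin 1 _ (fun=> phi a))// L_cst// addr0 !mul1r L_sum// L_sum//.
rewrite (funext (fun x => pd_cyl m gs phi nu x Dgs sphi)).
rewrite (pd2_cyl_tsym m gs phi nu b Dgs sphi bE).
have DDt i j : DD D (tsym (gs i) (gs j)) by exact: DD_tsym.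
have DDs i : DD D (fun p => \sum_j b i j * tsym (gs i) (gs j) p).
  exact: (lin_closed_sum _ _ _ (b i) _ DD_closed (DDt i)).
rewrite (lin_on_fun_sum _ _ Qop _ _ (fun=> 1) _ DD_closed Qop_lin DDs).
have -> : (fun x => \sum_i gs i x * pderiv i phi (mrow gs nu)) = fun x => \sum_i al i * gs i x.
  by apply/funext => x; apply: eq_bigr => i _; rewrite mulrC.
rewrite (lin_on_fun_sum _ _ Bop _ _ al gs D_closed Bop_lin Dgs); congr (_ + _).
  by apply: eq_bigr => i _; rewrite Ld.
rewrite mulr_sumr; apply: eq_bigr => i _; rewrite !mul1r.
rewrite (L_sum _ _ (b i) (fun j mu => d i mu * d j mu) nu (Ddd i)).
rewrite (lin_on_fun_sum _ _ Qop _ _ (b i) _ DD_closed Qop_lin (DDt i)) mulr_sumr.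
by apply: eq_bigr => j _; rewrite Ldd mulrCA.
Qed.

End FixedCylinder.

Lemma L_rep (f : MM R T -> R) nu : Mplus nu -> Dcal D f ->
  L f nu = Bop (pd f nu) nu + 2^-1 * Qop (pd2 f nu) nu.
Proof.
move=> nu0 Df; suff [] : Dcal D f /\ L f nu = Bop (pd f nu) nu + 2^-1 * Qop (pd2 f nu) nu by [].
apply: (span_ind _ (fun f : MM R T -> R => Dcal D f /\ L f nu = Bop (pd f nu) nu + 2^-1 * Qop (pd2 f nu) nu) _ _ f Df).
  split; first exact: span0.
  by rewrite cyl0; apply: L_cyl => [[]//|//|]; left; exact: pf_const.
move=> c g h Bg _ [Dh Lh]; have Dg := span_base _ _ Bg.
have Lg : L g nu = Bop (pd g nu) nu + 2^-1 * Qop (pd2 g nu) nu.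
  by apply: (Dbasic_ind (fun g : MM R T -> R => L g nu = Bop (pd g nu) nu + 2^-1 * Qop (pd2 g nu) nu) _ g Bg) => m gs phi Dgs adm; exact: L_cyl.
split; first exact: (proj2 Dcal_closed c _ _ Dg Dh).
have rg := Dcal_regular _ Dg; have rh := Dcal_regular _ Dh.
have [dg _ pg ppg] := rg; have [dh _ ph pph] := rh.
rewrite (L_lin c g h nu Dg Dh) Lg Lh (pd_lin c _ _ nu dg dh) (pd2_lin c _ _ nu rg rh).
rewrite (Bop_lin c _ _ (pg nu) (ph nu)) (Qop_lin c _ _ (ppg nu) (pph nu)).
have E (x y z w : R) : c * (x + 2^-1 * y) + (z + 2^-1 * w) = (c * x + z) + 2^-1 * (c * y + w) by ring.
exact: E.
Qed.

(** * From affine type to the representation *)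

Definition affine_on_Mplus (u : MM R T -> R) := exists (c : R) b, CDelta b /\
  forall nu, Mplus nu -> u nu = c + mint b nu.

Lemma affine_on_Mplus_lin (c : R) (u v : MM R T -> R) :
  affine_on_Mplus u -> affine_on_Mplus v -> affine_on_Mplus (fun nu => c * u nu + v nu).
Proof.
move=> [c1 [b1 [C1 E1]]] [c2 [b2 [C2 E2]]].
exists (c * c1 + c2), (fun x => c * b1 x + b2 x); split; first exact: CDelta_lin.
by move=> nu nu0; rewrite E1// E2// mint_lin//; ring.
Qed.

(** Recovers the density of an affine function from its values at unit masses and at zero. Being an
    explicit formula, it is linear in [u], as choosing a density for each [u] would not
    guarantee. *)
Definition slope (u : MM R T -> R) : T -> R :=
  fun x => u (charge_of_finite_measure (@dirac _ (borelT T) x R)) - u czero.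

Lemma affine_on_MplusE (u : MM R T -> R) : affine_on_Mplus u ->
  CDelta (slope u) /\ forall nu, Mplus nu -> u nu = u czero + mint (slope u) nu.
Proof.
move=> [c [b [Cb E]]].
have -> : slope u = b.
  apply/funext => x; rewrite /slope (E _ (Mplus_dirac x)) (E _ Mplus_czero).
  by rewrite (mint_dirac _ _ Cb) (mint_czero _ Cb); ring.
by split => // nu nu0; rewrite (E _ nu0) (E _ Mplus_czero) (mint_czero _ Cb) addr0.
Qed.

Section Affine.
Variables (F : (T -> R) -> R) (Rf : (T -> R) -> T -> R).
Hypothesis L_aff : affine_wit D L F Rf.

Lemma affine_Dminus g nu : Dminus D g -> Mplus nu ->
  Bop g nu + 2^-1 * Qop (tsq g) nu = F g + mint (Rf g) nu.
Proof.
move=> Dg nu0; have [CR HL] := L_aff; have Dg1 := proj1 Dg.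
have De := Dcal_expf g Dg1.
have eE mu : Mplus mu -> expf g mu = expR (mint g mu) by exact: expfE.
have := HL g Dg _ De eE nu nu0.
have [pde pd2e] := exp_pd _ _ De Dg1 eE nu nu0.
rewrite L_rep// pde pd2e.
rewrite (lin_on_funZ _ _ Bop _ _ D_closed Bop_lin Dg1).
rewrite (lin_on_funZ _ _ Qop _ _ DD_closed Qop_lin (DD_tsq _ Dg1)).
set e := expR _ => H; have e0 : e != 0 by rewrite expR_eq0.
by apply: (mulfI e0); rewrite [RHS]mulrC -H; ring.
Qed.

Lemma Dminus2 g : Dminus D g -> Dminus D (fun x => 2 * g x).
Proof.
move=> [Dg g0]; split; first exact: D_scale.
by move=> x; have := g0 x; lra.
Qed.

Lemma tsqZ (c : R) g : tsq (fun x => c * g x) = fun p => c ^+ 2 * tsq g p.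
Proof. by apply/funext => p; rewrite /tsq; ring. Qed.

(** Let A(g) be [F g + mint (Rf g) nu]. As [Bop] has degree 1 and [Qop (tsq g)] degree 2 in [g], the
    relations B + Q/2 = A(g) and 2B + 2Q = A(2g) give B = 2A(g) - A(2g)/2 and Q = 2(A(g) - B). *)
Lemma affine_Bop_Qop_Dminus g : Dminus D g ->
  affine_on_Mplus (Bop g) /\ affine_on_Mplus (Qop (tsq g)).
Proof.
move=> Dg; have Dg1 := proj1 Dg; have [CR _] := L_aff.
have D2g := Dminus2 _ Dg; have D2g1 := proj1 D2g.
have C1 := CR _ Dg1; have C2 := CR _ D2g1.
have E nu : Mplus nu -> Bop g nu = 2 * (F g + mint (Rf g) nu)
    - 2^-1 * (F (fun x => 2 * g x) + mint (Rf (fun x => 2 * g x)) nu).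
  move=> nu0; rewrite -!affine_Dminus// tsqZ.
  rewrite (lin_on_funZ _ _ Bop _ _ D_closed Bop_lin Dg1).
  rewrite (lin_on_funZ _ _ Qop _ _ DD_closed Qop_lin (DD_tsq _ Dg1)).
  by field.
have AB : affine_on_Mplus (Bop g).
  exists (2 * F g - 2^-1 * F (fun x => 2 * g x)),
    (fun x => 2 * Rf g x + (- 2^-1 * Rf (fun x => 2 * g x) x + 0)); split.
    by apply: CDelta_lin => //; apply: CDelta_lin => //; exact: CDelta_cst.
  move=> nu nu0; have C0 := CDelta_cst 0 : @CDelta R T _.
  by rewrite E// !mint_lin ?mint_cst0//; [ring|exact: CDelta_lin].
split=> //; have A1 : affine_on_Mplus (fun nu => F g + mint (Rf g) nu) by exists (F g), (Rf g).
have [c [b [Cb H]]] := affine_on_Mplus_lin (-1) _ _ AB A1.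
exists (2 * c), (fun x => 2 * b x); split; first exact: CDeltaZ.
by move=> nu nu0; rewrite mintZ// -mulrDr -H// -affine_Dminus//; field.
Qed.

(** Subtracting an upper bound makes [g] non-positive, and the constant [- M] is itself in
    [Dminus D]. *)
Lemma D_Dminus_split g : D g -> exists (u v : T -> R),
  [/\ Dminus D u, Dminus D v & forall x, g x = u x - v x].
Proof.
move=> Dg; have [M [M0 gM]] := CDelta_bounded g (D_CDelta _ Dg).
exists (fun x => g x + - M), (fun=> - M); split.
- split; first by apply: D_add => //; exact: D_cst.
  by move=> x; have := le_trans (ler_norm _) (gM x); lra.
- by split; [exact: D_cst|move=> _; lra].
- by move=> x; ring.
Qed.

Lemma Dminus_add u v : Dminus D u -> Dminus D v -> Dminus D (fun x => u x + v x).
Proof.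
move=> [Du u0] [Dv v0]; split; first exact: D_add.
by move=> x; have := u0 x; have := v0 x; lra.
Qed.

Lemma affine_Bop g : D g -> affine_on_Mplus (Bop g).
Proof.
move=> /D_Dminus_split [u [v [Du Dv E]]].
have -> : g = fun x => -1 * v x + u x by apply/funext => x; rewrite E; ring.
rewrite (Bop_lin _ _ _ (proj1 Dv) (proj1 Du)); apply: affine_on_Mplus_lin.
  by have [] := affine_Bop_Qop_Dminus v Dv.
by have [] := affine_Bop_Qop_Dminus u Du.
Qed.

(** For [g = u - v], the parallelogram identity expresses the square of [g] by those of [u], [v] and
    [u + v], all of which are non-positive. *)
Lemma affine_Qop_tsq g : D g -> affine_on_Mplus (Qop (tsq g)).
Proof.
move=> /D_Dminus_split [u [v [Du Dv E]]].
have Duv := Dminus_add _ _ Du Dv.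
have DDu := DD_tsq _ (proj1 Du); have DDv := DD_tsq _ (proj1 Dv); have DDuv := DD_tsq _ (proj1 Duv).
have -> : tsq g = fun p => 2 * tsq u p + (2 * tsq v p + (-1) * tsq (fun x => u x + v x) p).
  by apply/funext => p; rewrite /tsq !E; ring.
have DDuv' := proj2 DD_closed (-1) _ _ DDuv (proj1 DD_closed).
have A w : Dminus D w -> affine_on_Mplus (Qop (tsq w)) by move=> /affine_Bop_Qop_Dminus [].
have ZE : (fun p => (-1) * tsq (fun x => u x + v x) p) = fun p => -1 * tsq (fun x => u x + v x) p + 0.
  by apply/funext => p; rewrite addr0.
have D1 : DD D (fun p => (-1) * tsq (fun x => u x + v x) p) by rewrite ZE.
rewrite (Qop_lin _ _ _ DDu (proj2 DD_closed 2 _ _ DDv D1)) (Qop_lin _ _ _ DDv D1).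
apply: affine_on_Mplus_lin; first exact: A.
apply: affine_on_Mplus_lin; first exact: A.
rewrite (lin_on_funZ _ _ Qop _ _ DD_closed Qop_lin DDuv).
have A0 : affine_on_Mplus (fun=> 0).
  by exists 0, (fun=> 0); split; [exact: CDelta_cst|move=> nu _; rewrite mint_cst0 addr0].
have := affine_on_Mplus_lin (-1) _ _ (A _ Duv) A0.
by rewrite (_ : (fun nu => _) = fun nu => -1 * Qop (tsq (fun x => u x + v x)) nu)//; apply/funext => nu; rewrite addr0.
Qed.

Lemma affine_Qop (h : T * T -> R) : DD D h -> affine_on_Mplus (Qop h).
Proof.
move=> Dh; suff [] : DD D h /\ affine_on_Mplus (Qop h) by [].
apply: (span_ind _ (fun h : T * T -> R => DD D h /\ affine_on_Mplus (Qop h)) _ _ h Dh).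
  split; first exact: span0.
  rewrite (lin_on_fun0 _ _ Qop DD_closed Qop_lin).
  by exists 0, (fun=> 0); split; [exact: CDelta_cst|move=> nu _; rewrite mint_cst0 addr0].
move=> c _ k [g Dg <-] _ [Dk Ak]; have DDg := DD_tsq _ Dg.
split; first exact: (proj2 DD_closed c _ _ DDg Dk).
by rewrite (Qop_lin c _ _ DDg Dk); exact: (affine_on_Mplus_lin c _ _ (affine_Qop_tsq g Dg) Ak).
Qed.

Lemma slope_lin (c : R) (u v : MM R T -> R) :
  slope (fun nu => c * u nu + v nu) = fun x => c * slope u x + slope v x.
Proof.
apply/funext => x; rewrite /slope.
by rewrite mulrBr opprD addrACA.
Qed.

(** The constant part of an affine function is its value at the zero measure, its linear part is
    [slope]; both depend linearly on the function, which makes the four operators linear. *)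
Theorem affine_derivation_rep : is_rep D L (Bop^~ czero) (fun g => slope (Bop g))
  (Qop^~ czero) (fun h : T * T -> R => slope (Qop h)).
Proof.
split; first by move=> c f g Df Dg; rewrite (Bop_lin c _ _ Df Dg).
split; first by move=> c f g Df Dg; rewrite (Bop_lin c _ _ Df Dg) slope_lin.
split; first by move=> g Dg; have [] := affine_on_MplusE _ (affine_Bop g Dg).
split; first by move=> c f g Df Dg; rewrite (Qop_lin c _ _ Df Dg).
split; first by move=> c f g Df Dg; rewrite (Qop_lin c _ _ Df Dg) slope_lin.
split; first by move=> g Dg; have [] := affine_on_MplusE _ (affine_Qop g Dg).
move=> f Df nu nu0; rewrite (L_rep _ _ nu0 Df); have [_ _ pf ppf] := Dcal_regular _ Df.
have [_ EB] := affine_on_MplusE _ (affine_Bop _ (pf nu)).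
have [_ EQ] := affine_on_MplusE _ (affine_Qop _ (ppf nu)).
by rewrite (EB nu nu0) (EQ nu nu0).
Qed.

End Affine.
End Derivation.
End Operator.

(** * From a representation back to the affine and derivation properties, and uniqueness *)

Section Representation.
Variable L : (MM R T -> R) -> (MM R T -> R).
Variables (B0 : (T -> R) -> R) (B1 : (T -> R) -> T -> R)
  (Q0 : (T * T -> R) -> R) (Q1 : (T * T -> R) -> T -> R).
Hypothesis L_is_rep : is_rep D L B0 B1 Q0 Q1.

Definition rep_F g := B0 g + 2^-1 * Q0 (tsq g).
Definition rep_R g : T -> R := fun x => B1 g x + 2^-1 * Q1 (tsq g) x.

Lemma CDelta_rep_R g : D g -> CDelta (rep_R g).
Proof.
move=> Dg; have [_ [_ [CB [_ [_ [CQ _]]]]]] := L_is_rep.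
rewrite (_ : rep_R g = fun x => 2^-1 * Q1 (tsq g) x + B1 g x).
  by apply: CDelta_lin; [apply: CQ; exact: DD_tsq|exact: CB].
by apply/funext => x; rewrite /rep_R addrC.
Qed.

(** By [exp_pd] both derivatives carry the scalar [exp <g, nu>], which linearity pulls out of all
    four operators. *)
Lemma rep_affine_wit : affine_wit D L rep_F rep_R.
Proof.
split; first exact: CDelta_rep_R.
move=> g [Dg _] f Df fE nu nu0; have [LB0 [LB1 [CB [LQ0 [LQ1 [CQ repE]]]]]] := L_is_rep.
have [pfE ppfE] := exp_pd _ _ Df Dg fE nu nu0.
have DDg := DD_tsq _ Dg.
rewrite repE// pfE ppfE.
rewrite (lin_on_RZ _ B0 _ _ D_closed LB0 Dg) (lin_on_funZ _ _ B1 _ _ D_closed LB1 Dg).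
rewrite (lin_on_RZ _ Q0 _ _ DD_closed LQ0 DDg) (lin_on_funZ _ _ Q1 _ _ DD_closed LQ1 DDg).
have CBg := CB _ Dg; have CQg := CQ _ DDg.
have -> : rep_R g = fun x => 2^-1 * Q1 (tsq g) x + B1 g x.
  by apply/funext => x; rewrite /rep_R addrC.
rewrite (mintZ _ _ nu CBg) (mintZ _ _ nu CQg) (mint_lin _ _ _ nu CQg CBg) /rep_F.
have E (e b0 b1 q0 q1 : R) : e * b0 + e * b1 + 2^-1 * (e * q0 + e * q1) =
    (b0 + 2^-1 * q0 + (2^-1 * q1 + b1)) * e by ring.
exact: E.
Qed.

Definition rep_B nu g := B0 g + mint (B1 g) nu.
Definition rep_Q nu (h : T * T -> R) := 2^-1 * (Q0 h + mint (Q1 h) nu).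

Lemma rep_Q_lin nu : lin_on_R (DD D) (rep_Q nu).
Proof.
have [_ [_ [_ [LQ0 [LQ1 [CQ _]]]]]] := L_is_rep.
move=> c h k Dh Dk; rewrite /rep_Q (LQ0 c _ _ Dh Dk) (LQ1 c _ _ Dh Dk).
rewrite (mint_lin _ _ _ nu (CQ _ Dh) (CQ _ Dk)).
have E (x y z w : R) : 2^-1 * (c * x + z + (c * y + w)) = c * (2^-1 * (x + y)) + 2^-1 * (z + w) by ring.
exact: E.
Qed.

Lemma rep_B_lin nu : lin_on_R D (rep_B nu).
Proof.
have [LB0 [LB1 [CB _]]] := L_is_rep.
move=> c h k Dh Dk; rewrite /rep_B (LB0 c _ _ Dh Dk) (LB1 c _ _ Dh Dk).
rewrite (mint_lin _ _ _ nu (CB _ Dh) (CB _ Dk)).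
have E (x y z w : R) : c * x + z + (c * y + w) = c * (x + y) + (z + w) by ring.
exact: E.
Qed.

Lemma pd2_mul (p q : MM R T -> R) nu : regular p -> regular q ->
  pd2 (fun mu => p mu * q mu) nu =
  fun z => p nu * pd2 q nu z + (q nu * pd2 p nu z + tsym (pd p nu) (pd q nu) z).
Proof.
move=> [dp dp2 _ _] [dq dq2 _ _]; apply/funext => -[x y]; rewrite /pd2 /=.
rewrite (_ : (fun mu => pd _ mu y) = fun mu => 1 * (p mu * pd q mu y) + q mu * pd p mu y); last first.
  by apply/funext => mu; rewrite (pd_mul _ _ _ dp dq) mul1r.
have d1 := pd_derivable_mul _ _ dp (dq2 y); have d2 := pd_derivable_mul _ _ dq (dp2 y).
rewrite (pd_lin _ _ _ _ d1 d2) (pd_mul _ _ _ dp (dq2 y)) (pd_mul _ _ _ dq (dp2 y)) /tsym /=.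
have E (p0 q0 px qx py qy pxy qxy : R) : 1 * (p0 * qxy + qy * px) + (q0 * pxy + py * qx) =
  p0 * qxy + (q0 * pxy + (px * qy + qx * py)) by ring.
exact: E.
Qed.

(** The terms where both derivatives fall on the same factor are cancelled by [p L q + q L p],
    together with all of the first-order part; what survives is the cross term of the second-order
    Leibniz rule. *)
Lemma rep_Gamma (p q : MM R T -> R) nu : Mplus nu -> Dcal D p -> Dcal D q ->
  Dcal D (fun mu => p mu * q mu) ->
  Gamma L p q nu = rep_Q nu (tsym (pd p nu) (pd q nu)).
Proof.
move=> nu0 Dp Dq Dpq; have [_ [_ [_ [_ [_ [_ repE]]]]]] := L_is_rep.
have rE (f : MM R T -> R) : Dcal D f -> L f nu = rep_B nu (pd f nu) + rep_Q nu (pd2 f nu).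
  by move=> Df; rewrite repE.
have rp := Dcal_regular _ Dp; have rq := Dcal_regular _ Dq.
have [dp _ Dpp DDp] := rp; have [dq _ Dpdq DDq] := rq.
have Dt : DD D (tsym (pd p nu) (pd q nu)) by exact: DD_tsym.
rewrite /Gamma (rE _ Dpq) (rE _ Dp) (rE _ Dq) (pd2_mul _ _ _ rp rq) (pd_mul _ _ _ dp dq).
have DDt := proj2 DD_closed (q nu) _ _ (DDp nu) Dt.
rewrite (rep_Q_lin nu _ _ _ (DDq nu) DDt) (rep_Q_lin nu _ _ _ (DDp nu) Dt).
rewrite (rep_B_lin nu _ _ _ (Dpdq nu) (D_scale (q nu) _ (Dpp nu))).
rewrite (lin_on_RZ _ (rep_B nu) _ _ D_closed (rep_B_lin nu) (Dpp nu)).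
have E (p0 q0 bp bq qp qq t : R) : p0 * bq + q0 * bp + (p0 * qq + (q0 * qp + t)) -
  p0 * (bq + qq) - q0 * (bp + qp) = t by ring.
exact: E.
Qed.

Lemma rep_derivation : derivation D L.
Proof.
move=> p q r Dp Dq Dr Dpq Dqr Dpr Dpqr nu nu0.
rewrite (rep_Gamma _ _ _ nu0 Dpq Dr Dpqr) (rep_Gamma _ _ _ nu0 Dq Dr Dqr) (rep_Gamma _ _ _ nu0 Dp Dr Dpr).
have [dp _ Dpp _] := Dcal_regular _ Dp; have [dq _ Dpdq _] := Dcal_regular _ Dq.
have [_ _ Dpdr _] := Dcal_regular _ Dr.
have D1 : DD D (tsym (pd q nu) (pd r nu)) by exact: DD_tsym.
have D2 : DD D (tsym (pd p nu) (pd r nu)) by exact: DD_tsym.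
rewrite (pd_mul _ _ _ dp dq).
have D3 : DD D (fun z => q nu * tsym (pd p nu) (pd r nu) z).
  have := proj2 DD_closed (q nu) _ _ D2 (proj1 DD_closed).
  by under eq_fun do rewrite addr0.
have -> : tsym (fun x => p nu * pd q nu x + q nu * pd p nu x) (pd r nu) =
    fun z => p nu * tsym (pd q nu) (pd r nu) z + q nu * tsym (pd p nu) (pd r nu) z.
  apply/funext => z; rewrite /tsym.
  have E (p0 q0 p1 q1 r1 p2 q2 r2 : R) : (p0 * q1 + q0 * p1) * r2 + r1 * (p0 * q2 + q0 * p2) =
    p0 * (q1 * r2 + r1 * q2) + q0 * (p1 * r2 + r1 * p2) by ring.
  exact: E.
rewrite (rep_Q_lin nu _ _ _ D1 D3).
by rewrite (lin_on_RZ _ (rep_Q nu) _ _ DD_closed (rep_Q_lin nu) D2).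
Qed.

(** Testing both witnesses on [expf g] and cancelling the exponential equates two affine functions
    of [nu]; the zero measure isolates [F g], and unit masses then give [Rf g] point by point. *)
Lemma affine_rep_unique F Rf : affine_wit D L F Rf ->
  forall g, Dminus D g -> F g = rep_F g /\ Rf g = rep_R g.
Proof.
move=> [CR HL] g Dg; have Dg1 := proj1 Dg.
have De := Dcal_expf g Dg1.
have eE mu : Mplus mu -> expf g mu = expR (mint g mu) by exact: expfE.
have E nu : Mplus nu -> F g + mint (Rf g) nu = rep_F g + mint (rep_R g) nu.
  move=> nu0; have := HL g Dg _ De eE nu nu0.
  rewrite (proj2 rep_affine_wit g Dg _ De eE nu nu0) => /mulIf -> //.
  by rewrite expR_eq0.
have C1 := CR _ Dg1; have C2 := CDelta_rep_R _ Dg1.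
have E0 := E _ Mplus_czero; rewrite !mint_czero// !addr0 in E0.
split => //; apply/funext => x; have := E _ (Mplus_dirac x).
by rewrite !mint_dirac// E0 => /addrI.
Qed.

End Representation.

(** The second representation yields an affine witness, to which the uniqueness for the first
    applies. Comparing at [g] and [2 g] separates the linear from the quadratic part, and induction
    over the span extends the latter to [DDminus D]. *)
Lemma rep_unique (L : (MM R T -> R) -> (MM R T -> R)) B0 B1 Q0 Q1 B0' B1' Q0' Q1' :
  is_rep D L B0 B1 Q0 Q1 -> is_rep D L B0' B1' Q0' Q1' ->
  (forall g, Dminus D g -> B0 g = B0' g /\ B1 g = B1' g) /\
  (forall h : T * T -> R, DDminus D h -> Q0 h = Q0' h /\ Q1 h = Q1' h).
Proof.
move=> rep rep'.
have [LB0 [LB1 [_ [LQ0 [LQ1 _]]]]] := rep; have [LB0' [LB1' [_ [LQ0' [LQ1' _]]]]] := rep'.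
have U := affine_rep_unique _ _ _ _ _ rep _ _ (rep_affine_wit _ _ _ _ _ rep').
have H g : Dminus D g -> [/\ B0 g = B0' g, B1 g = B1' g, Q0 (tsq g) = Q0' (tsq g) & Q1 (tsq g) = Q1' (tsq g)].
  move=> Dg; have Dg1 := proj1 Dg; have DDg := DD_tsq _ Dg1.
  have [F1 R1] := U g Dg; have [F2 R2] := U _ (Dminus2 g Dg).
  move: F2 R2; rewrite /rep_F /rep_R tsqZ.
  rewrite !(lin_on_RZ _ _ _ _ D_closed _ Dg1)// !(lin_on_funZ _ _ _ _ _ D_closed _ Dg1)//.
  rewrite !(lin_on_RZ _ _ _ _ DD_closed _ DDg)// !(lin_on_funZ _ _ _ _ _ DD_closed _ DDg)//.
  move: F1 R1; rewrite /rep_F /rep_R => F1 R1 F2 R2.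
  have R1x x := congr1 (@^~ x) R1; have R2x x := congr1 (@^~ x) R2; rewrite /= in R1x R2x.
  split; [lra| |lra|]; apply/funext => x; have := R1x x; have := R2x x; lra.
split; first by move=> g /H [].
have DDm (h : T * T -> R) : DDminus D h -> DD D h.
  by case=> n [c [fs [Hfs ->]]]; exists n, c, fs; split => // k; have [g [Dg _] <-] := Hfs k; exists g.
move=> h Dh; apply: (span_ind _ (fun h : T * T -> R => Q0 h = Q0' h /\ Q1 h = Q1' h) _ _ h Dh).
  rewrite (lin_on_R0 _ Q0 DD_closed LQ0) (lin_on_R0 _ Q0' DD_closed LQ0').
  by rewrite (lin_on_fun0 _ _ Q1 DD_closed LQ1) (lin_on_fun0 _ _ Q1' DD_closed LQ1').
move=> c _ k [g Dg <-] Dk [k0 k1]; have [_ _ g0 g1] := H g Dg.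
have DDg := DD_tsq _ (proj1 Dg); have DDk := DDm _ Dk.
by rewrite (LQ0 c _ _ DDg DDk) (LQ0' c _ _ DDg DDk) (LQ1 c _ _ DDg DDk) (LQ1' c _ _ DDg DDk) g0 g1 k0 k1.
Qed.

End Cylinder.

Theorem theorem6p2 (R : realType) (T : ptopologicalType) (D : set (T -> R))
  (L : (MM R T -> R) -> (MM R T -> R)) :
  locally_compact_polish R T ->
  dense_subspace_with_one D ->
  linear_L D L ->
  (forall f, Dcal D f -> Mmeasurable (L f)) ->
  ((affine_type D L /\ derivation D L) <->
     exists B0 B1 Q0 Q1, is_rep D L B0 B1 Q0 Q1)
  /\ (forall B0 B1 Q0 Q1 B0' B1' Q0' Q1',
        is_rep D L B0 B1 Q0 Q1 -> is_rep D L B0' B1' Q0' Q1' ->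
        (forall g, Dminus D g -> B0 g = B0' g /\ B1 g = B1' g) /\
        (forall h, DDminus D h -> Q0 h = Q0' h /\ Q1 h = Q1' h))
  /\ (forall F Rf B0 B1 Q0 Q1,
        affine_wit D L F Rf -> is_rep D L B0 B1 Q0 Q1 ->
        forall g, Dminus D g ->
          F g = B0 g + 2^-1 * Q0 (tsq g) /\
          Rf g = (fun x => B1 g x + 2^-1 * Q1 (tsq g) x)).
Proof.
move=> _ [D_CDelta [D_one [D_lin _]]] L_linear _; split; [split|split].
- move=> [[F [Rf Laff]] Lder].
  by do 4 eexists; apply: (affine_derivation_rep D D_CDelta D_one D_lin L L_linear Lder F Rf Laff).
- move=> [B0 [B1 [Q0 [Q1 rep]]]]; split.
    by exists (rep_F B0 Q0), (rep_R B1 Q1); exact: (rep_affine_wit D D_CDelta D_one D_lin).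
  exact: (rep_derivation D D_CDelta D_one D_lin _ _ _ _ _ rep).
- move=> B0 B1 Q0 Q1 B0' B1' Q0' Q1'; exact: (rep_unique D D_CDelta D_one D_lin).
- move=> F Rf B0 B1 Q0 Q1 Laff rep; exact: (affine_rep_unique D D_CDelta D_one D_lin _ _ _ _ _ rep).
Qed.
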